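(* Let $d\ge 2$ be an integer, $\lambda=\frac{d-2}{2}$, $x\in[-1,1]$, and let $e_0(x)=1$ for all $x\in[-1,1]$. The thinplate spline functions $k_{d,m}$, $m\in\mathbb{N}=\{1,2,\dots\}$, for the sphere $\mathbb{S}^{d-1}$, defined via the series $$k_{d,m}(x)=\sum_{n=1}^\infty [n(n+d-2)]^{-m}\,N_{d,n}\,W_n^\lambda(x),$$ are alternatively generated by the recurrence $$k_{d,m}(x)=\begin{cases}\dfrac{[e_0,T_\lambda e_0]_\lambda}{[e_0,e_0]_\lambda}-(T_\lambda e_0)(x), & m=1,\\[2ex] (T_\lambda k_{d,m-1})(x)-\dfrac{[e_0,T_\lambda k_{d,m-1}]_\lambda}{[e_0,e_0]_\lambda}, & m>1.\end{cases}$$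
   Context: Here $N_{d,n}=\binom{n+d-1}{n}-\binom{n+d-3}{n-2}$ (with $\binom{a}{-1}=0$) is the dimension of the space of spherical harmonics of degree $n\ge1$ on $\mathbb{S}^{d-1}\subset\mathbb{R}^d$. $W_n^\lambda$ is the Gegenbauer polynomial of order $\lambda$ and degree $n$ normalized so that $W_n^\lambda(1)=1$, i.e. $W_n^\lambda(x)={}_2F_1\left(-n,\,n+2\lambda;\,\lambda+\tfrac12;\,\tfrac{1-x}{2}\right)$. The inner product is $[f,g]_\lambda=\int_{-1}^1 f(x)g(x)(1-x^2)^{\lambda-\frac12}\,dx$, and the operator $T_\lambda$ is $$T_\lambda f(x)=-\int_{-1}^x (1-y^2)^{-\lambda-\frac12}\int_{-1}^y (1-z^2)^{\lambda-\frac12}f(z)\,dz\,dy .$$ The series defining $k_{d,m}$ is viewed as an orthogonal expansion in Gegenbauer polynomials: $k_{d,m}$ is the function, continuous on $[-1,1)$ and integrable on $[-1,1]$ with respect to the weight $(1-x^2)^{\lambda-\frac12}$, whose Gegenbauer (Fourier) expansion is the displayed series, that is, $[k_{d,m},W_0^\lambda]_\lambda=0$ and $[k_{d,m},W_n^\lambda]_\lambda/[W_n^\lambda,W_n^\lambda]_\lambda=[n(n+d-2)]^{-m}N_{d,n}$ for $n\ge1$. Values at $x=1$ are understood as limits as $x\to1^-$ and may be $+\infty$. *)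

(* Defs.v *)
From HB Require Import structures.
From mathcomp Require Import all_boot all_order all_algebra.
From mathcomp Require Import all_classical all_reals all_analysis.
Import Order.TTheory GRing.Theory Num.Theory.
Import numFieldNormedType.Exports.

Set Implicit Arguments.
Unset Strict Implicit.
Unset Printing Implicit Defensive.

Local Open Scope classical_set_scope.
Local Open Scope ring_scope.

(* Functions on [-1, 1] that may be infinite at x = 1 are represented as total
   functions R -> \bar R, of which only the restriction to [-1, 1] matters. *)

(* The binomial coefficient binom(n + d - 3, n - 2) is 0 for n = 1, whereas
   'C(n + d - 3, n - 2) would be 1 because of the truncated subtraction. *)
Definition dim_harmonics (R : realType) (d n : nat) : R :=
  'C((n + d - 1)%N, n)%:R - (if (n < 2)%N then 0 else 'C((n + d - 3)%N, (n - 2)%N)%:R).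

Definition pochhammer (R : realType) (a : R) (j : nat) : R :=
  \prod_(i < j) (a + i%:R).

(* 2F1(-n, b; c; z): all terms of index greater than n vanish. *)
Definition hypergeo_poly (R : realType) (n : nat) (b c z : R) : R :=
  \sum_(j < n.+1) pochhammer (- n%:R) j * pochhammer b j
                  / (pochhammer c j * j`!%:R) * z ^+ j.

Definition gegenbauer (R : realType) (lam : R) (n : nat) (x : R) : R :=
  hypergeo_poly n (n%:R + 2 * lam) (lam + 2^-1) ((1 - x) / 2).

(* Here 0 `^ a = 0 for a < 0, so the weights below are finite at the endpoints;
   the endpoints are negligible for every integral in which they occur. *)
Definition gweight (R : realType) (a x : R) : R := (1 - x ^+ 2) `^ a.

Definition ginner (R : realType) (lam : R) (f g : R -> \bar R) : \bar R :=
  (\int[@lebesgue_measure R]_(x in `[(-1)%R, 1%R])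
     (f x * g x * (gweight (lam - 2^-1) x)%:E))%E.

Definition Top (R : realType) (lam : R) (f : R -> \bar R) (x : R) : \bar R :=
  (- \int[@lebesgue_measure R]_(y in `[(-1)%R, x])
       ((gweight (- lam - 2^-1) y)%:E *
        \int[@lebesgue_measure R]_(z in `[(-1)%R, y])
          ((gweight (lam - 2^-1) z)%:E * f z)))%E.

Definition e0 (R : realType) : R -> \bar R := cst 1%E.
Arguments e0 : clear implicits.

Definition lambda_of (R : realType) (d : nat) : R := (d%:R - 2) / 2.

Record is_thinplate_spline (R : realType) (d m : nat) (k : R -> \bar R) : Prop :=
  IsThinplateSpline {
    tps_finite : forall x : R, -1 <= x < 1 -> k x \is a fin_num ;
    tps_continuous : {within `[(-1)%R, 1%R[, continuous (fine \o k)} ;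
    tps_at1 : k x @[x --> (1 : R)^'-] --> k 1 ;
    tps_integrable :
      (@lebesgue_measure R).-integrable `[(-1)%R, 1%R]
        (fun x => (k x * (gweight (lambda_of R d - 2^-1) x)%:E)%E) ;
    tps_coef0 :
      ginner (lambda_of R d) k (EFin \o gegenbauer (lambda_of R d) 0) = 0%E ;
    tps_coef : forall n : nat, (1 <= n)%N ->
      let W := EFin \o gegenbauer (lambda_of R d) n in
      (ginner (lambda_of R d) k W / ginner (lambda_of R d) W W)%E =
      ((n%:R * (n%:R + d%:R - 2)) ^- m * dim_harmonics R d n)%:E
  }.

(* Main.v *)
Require Import Defs.
From mathcomp Require Import all_boot all_order all_algebra.
From mathcomp Require Import all_classical all_reals all_analysis.
From mathcomp Require Import measurable_realfun.
From mathcomp Require Import ring lra zify.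
Import Order.TTheory GRing.Theory Num.Theory.
Import numFieldNormedType.Exports.

(** Write [w x = (1 - x^2)^(lam - 1/2)] for the weight and [W n] for the
    Gegenbauer polynomials normalized by [W n (1) = 1]. They satisfy
    [((1 - x^2)^(lam + 1/2) W_n')' = - n (n + 2 lam) w W_n], and [T f] is the
    solution of the same equation with right-hand side [- w f] whose flux
    vanishes at [-1]. Hence, for [n >= 1],
<<
      n (n + 2 lam) [T f, W_n] = [f, W_n] - [f, 1],
>>
    the last term being the flux left at [1]. If [[f, 1] = 0], as for a spline,
    then [T] divides the [n]-th coefficient by [n (n + 2 lam)], and subtracting
    the mean restores a vanishing coefficient of degree [0]: this is the
    recurrence for [m > 1]. If [f = 1], the right-hand side is [- [1, 1]], and
    [[1, 1] = dim_harmonics d n * [W_n, W_n]] turns it into the coefficients of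
    the first spline. So each right-hand side of the recurrence is a spline, and
    both implications follow from the fact that a spline is determined by its
    coefficients.

    The coefficient formula is [potential_gegenbauer]. [T f] may be infinite at
    [1], so instead of integrating by parts one exchanges the order of
    integration twice ([triangle_fubini]); this only needs that near [1] the
    tail integral of [w] is at most [2 (1 - x^2)^(lam + 1/2)]
    ([integral_gweight_right_le]), which cancels the weight of the outer
    integral of [T].

    The norm formula [gegenbauer_norm] goes by induction on the degree for all
    dimensions at once: the derivative of [W_(n+1)] in dimension [d] is a
    multiple of [W_n] in dimension [d + 2], and integrating the differential
    equation against [W_(n+1)] relates the two norms.

    The limit at [1], possibly infinite, is the subject of
    [integral_cvg_at_left]: a spline has a limit at [1], so that it is bounded
    near [1] on one side at least, and then so is the integrand of [T], because
    the mass of the spline on [[-1, y]] is opposite to the one on [[y, 1]].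

    Uniqueness is [gegenbauer_complete]: a function integrable against the
    weight and orthogonal to all Gegenbauer polynomials is orthogonal to all
    polynomials, and powers of a polynomial peaking at a point show that it
    vanishes there. *)

Set Implicit Arguments.
Unset Strict Implicit.
Unset Printing Implicit Defensive.
Local Open Scope classical_set_scope.
Local Open Scope ring_scope.

(** * Gegenbauer polynomials *)

Section GegenbauerPolynomial.
Context {R : realType}.
Implicit Types (a b c lam x : R) (n j : nat).

Lemma pochhammerS a j : pochhammer a j.+1 = pochhammer a j * (a + j%:R).
Proof. by rewrite /pochhammer big_ord_recr. Qed.

Lemma pochhammerSl a j : pochhammer a j.+1 = a * pochhammer (a + 1) j.
Proof.
rewrite /pochhammer big_ord_recl addr0; congr (_ * _).
by apply: eq_bigr => i _; rewrite /= /bump /= natrD addrA.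
Qed.

Lemma pochhammer_gt0 a j : 0 < a -> 0 < pochhammer a j.
Proof. by move=> a0; apply: prodr_gt0 => i _; rewrite ltr_wpDr. Qed.

Lemma pochhammer_oppn_eq0 n j : (n < j)%N -> pochhammer (- n%:R : R) j = 0.
Proof.
move=> nj; apply/eqP; rewrite /pochhammer prodf_seq_eq0; apply/hasP.
by exists (Ordinal nj); rewrite ?mem_index_enum //= addNr.
Qed.

Lemma pochhammer_oppn_neq0 n : pochhammer (- n%:R : R) n != 0.
Proof.
rewrite prodf_seq_neq0; apply/allP => i _ /=.
by rewrite addrC subr_eq0 eqr_nat neq_ltn ltn_ord.
Qed.

Definition hypergeo_coef n b c j : R :=
  pochhammer (- n%:R) j * pochhammer b j / (pochhammer c j * j`!%:R).

Definition hypergeometric n b c : {poly R} :=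
  \poly_(j < n.+1) hypergeo_coef n b c j.

Lemma coef_hypergeometric n b c j :
  (hypergeometric n b c)`_j = hypergeo_coef n b c j.
Proof.
rewrite coef_poly ltnS; case: leqP => // nj.
by rewrite /hypergeo_coef pochhammer_oppn_eq0 // !mul0r.
Qed.

Lemma horner_hypergeometric n b c z :
  (hypergeometric n b c).[z] = hypergeo_poly n b c z.
Proof. by rewrite horner_poly. Qed.

Lemma hypergeo_coefS n b c j : 0 < c ->
  (j.+1)%:R * (c + j%:R) * hypergeo_coef n b c j.+1 =
  (j%:R - n%:R) * (b + j%:R) * hypergeo_coef n b c j.
Proof.
move=> c0; rewrite /hypergeo_coef !pochhammerS factS natrM.
have cj : c + j%:R != 0 by rewrite gt_eqF // ltr_wpDr.
have pc : pochhammer c j != 0 by rewrite gt_eqF // pochhammer_gt0.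
have fj : j`!%:R != 0 :> R by rewrite pnatr_eq0 -lt0n fact_gt0.
have j1 : (1 + j%:R : R) != 0 by rewrite nat1r pnatr_eq0.
by field; rewrite fj cj pc j1.
Qed.

(** In degree [j] the equation is the ratio of consecutive coefficients given
    by [hypergeo_coefS]. *)
Lemma hypergeometric_ode n lam : 0 < lam + 2^-1 ->
  let P := hypergeometric n (n%:R + 2 * lam) (lam + 2^-1) in
  'X * (1 - 'X) * P^`()^`() + (lam + 2^-1) *: ((1 - 'X *+ 2) * P^`())
    + (n%:R * (n%:R + 2 * lam)) *: P = 0.
Proof.
move=> c0 P; apply/polyP => j; rewrite coef0.
have rec := @hypergeo_coefS n (n%:R + 2 * lam) _ j c0.
rewrite -!coef_hypergeometric -/P in rec.
have -> : 'X * (1 - 'X) * P^`()^`() = 'X * P^`()^`() - 'X * ('X * P^`()^`()).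
  by ring.
have -> : (1 - 'X *+ 2) * P^`() = P^`() - 'X * P^`() *+ 2 by ring.
rewrite !(coefD, coefN, coefZ, coefMn, coefXM, coef_deriv).

transitivity ((j.+1%:R * (lam + 2^-1 + j%:R) * P`_j.+1) -
   (j%:R - n%:R) * (n%:R + 2 * lam + j%:R) * P`_j); last by rewrite rec subrr.
by case: j {rec} => [|[|j]] /=; field.
Qed.

Definition gegenbauer_poly lam n : {poly R} :=
  hypergeometric n (n%:R + 2 * lam) (lam + 2^-1) \Po ((1 - 'X) * (2^-1)%:P).

Lemma horner_gegenbauer lam n x :
  (gegenbauer_poly lam n).[x] = gegenbauer lam n x.
Proof.
by rewrite horner_comp horner_hypergeometric /gegenbauer !hornerE.
Qed.

Lemma deriv_comp_half (P : {poly R}) :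
  (P \Po ((1 - 'X) * (2^-1)%:P))^`() =
  (- 2^-1) *: (P^`() \Po ((1 - 'X) * (2^-1)%:P)).
Proof.
rewrite deriv_comp derivM derivC derivB derivX mulr0 addr0 -[1]/(1%:P) derivC.
by rewrite sub0r mulNr mul1r mulrN mulrC mul_polyC scaleNr.
Qed.

Lemma gegenbauer_ode lam n x : 0 < lam + 2^-1 ->
  let W := gegenbauer_poly lam n in
  (1 - x ^+ 2) * W^`()^`().[x] - (2 * lam + 1) * x * W^`().[x]
    = - (n%:R * (n%:R + 2 * lam)) * W.[x].
Proof.
move=> c0 W; rewrite /W /gegenbauer_poly deriv_comp_half derivZ deriv_comp_half.
have := congr1 (fun Q : {poly R} => Q.[(1 - x) * 2^-1])
  (@hypergeometric_ode n lam c0).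
set P := hypergeometric _ _ _.
rewrite !hornerE !horner_comp !hornerE /= => ode.
by rewrite -[RHS]addr0 -ode; field.
Qed.

(** Differentiating a hypergeometric series raises its three parameters by one;
    for Gegenbauer polynomials this lowers the degree by one and raises [lam] by
    one, that is, the dimension by two. *)
Lemma deriv_gegenbauer lam n : 0 < lam + 2^-1 ->
  (gegenbauer_poly lam n.+1)^`() =
  (n.+1%:R * (n.+1%:R + 2 * lam) / (2 * lam + 1)) *: gegenbauer_poly (lam + 1) n.
Proof.
move=> c0; rewrite /gegenbauer_poly deriv_comp_half -comp_polyZ -[RHS]comp_polyZ.
congr (_ \Po _); apply/polyP => j.
rewrite !coefZ coef_deriv !coef_hypergeometric /hypergeo_coef.
rewrite !pochhammerSl factS natrM -[X in _ * X = _]mulr_natr.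
have -> : - n.+1%:R + 1 = - n%:R :> R by rewrite -natr1; ring.
have -> : n.+1%:R + 2 * lam + 1 = n%:R + 2 * (lam + 1) by rewrite -natr1; ring.
have -> : lam + 2^-1 + 1 = lam + 1 + 2^-1 by ring.
have cj : lam + 2^-1 != 0 by rewrite gt_eqF.
have cj' : 2 * lam + 1 != 0 by rewrite gt_eqF //; lra.
have pc : pochhammer (lam + 1 + 2^-1) j != 0.
  by rewrite gt_eqF // pochhammer_gt0 //; lra.
have fj : j`!%:R != 0 :> R by rewrite pnatr_eq0 -lt0n fact_gt0.
have j1 : (1 + j%:R : R) != 0 by rewrite nat1r pnatr_eq0.
by field; rewrite fj pc j1 cj'; lra.
Qed.

Lemma gegenbauer_at1 lam n : (gegenbauer_poly lam n).[1] = 1.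
Proof.
rewrite horner_comp !hornerE subrr mul0r horner_coef0 coef_hypergeometric.
by rewrite /hypergeo_coef /pochhammer !big_ord0 fact0 !mulr1 divr1.
Qed.

Lemma gegenbauer0 lam : gegenbauer_poly lam 0 = 1.
Proof.
rewrite /gegenbauer_poly; suff -> : hypergeometric 0 (0%:R + 2 * lam) (lam + 2^-1) = 1.
  by rewrite comp_polyC.
apply/polyP => j; rewrite coef_poly coef1 ltnS leqn0.
case: eqP => //= ->; rewrite /hypergeo_coef /pochhammer !big_ord0.
by rewrite fact0 !mulr1 divr1.
Qed.

(** A linear form killing the Gegenbauer polynomials kills the powers of
    [(1 - x) / 2], by induction on the exponent, because the coefficient of
    degree [n] of the [n]-th hypergeometric polynomial does not vanish. *)
Lemma gegenbauer_span lam (V : {poly R} -> R) : 0 <= lam ->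
  (forall P Q, V (P + Q) = V P + V Q) ->
  (forall a P, V (a *: P) = a * V P) ->
  (forall n, V (gegenbauer_poly lam n) = 0) ->
  forall P : {poly R}, V P = 0.
Proof.
move=> lam0 VD VZ VW.
have V0 : V 0 = 0 by rewrite -(scale0r 0) VZ mul0r.
have Vsum m (F : nat -> {poly R}) :
    V (\sum_(i < m) F i) = \sum_(i < m) V (F i).
  by elim: m => [|m IH]; rewrite ?big_ord0 // !big_ord_recr /= VD IH.
pose Z : {poly R} := (1 - 'X) * (2^-1)%:P.
have VZn n : V (Z ^+ n) = 0.
  elim/ltn_ind: n => n IH; have := VW n.
  rewrite /gegenbauer_poly -/Z; set P := hypergeometric _ _ _.
  set a := hypergeo_coef n (n%:R + 2 * lam) (lam + 2^-1).
  have -> : P \Po Z = \sum_(i < n.+1) a i *: Z ^+ i.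
    rewrite /P /hypergeometric poly_def raddf_sum /=; apply: eq_bigr => i _.
    by rewrite comp_polyZ comp_Xn_poly.
  rewrite big_ord_recr /= VD (Vsum _ (fun i => a i *: Z ^+ i)) big1 => [|i _]; last first.
    by rewrite VZ IH ?mulr0.
  rewrite add0r VZ => /eqP; rewrite mulf_eq0 => /orP[|/eqP //].
  have c0 : 0 < lam + 2^-1 by lra.
  rewrite /a /hypergeo_coef mulf_eq0 invr_eq0 !mulf_eq0.
  rewrite (negPf (pochhammer_oppn_neq0 n)) (gt_eqF (pochhammer_gt0 n c0)).
  rewrite pnatr_eq0 gtn_eqF ?fact_gt0 //= !orbF.
  case: n {IH P a} => [|n]; first by rewrite /pochhammer big_ord0 oner_eq0.
  by rewrite gt_eqF // pochhammer_gt0 // ltr_wpDr ?mulr_ge0.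
move=> P; have -> : P = (P \Po (1 - 'X *+ 2)) \Po Z.
  rewrite -comp_polyA rmorphB rmorph1 rmorphMn /= comp_polyX.
  rewrite -[LHS]comp_polyXr; congr (_ \Po _); rewrite /Z.
  have h : (2^-1)%:P * 2 = 1 :> {poly R}.
    by rewrite -[2]/(2%:R) -polyC_natr -polyCM mulVf.
  rewrite -mulr_natr -mulrA h; ring.
set S := (P \Po _).
by rewrite comp_polyE (Vsum _ (fun i => S`_i *: Z ^+ i)) big1 // => i _; rewrite VZ VZn mulr0.
Qed.

Lemma dim_harmonicsE e n :
  dim_harmonics R e.+2 n.+1 * (n.+1)`!%:R * e`!%:R =
  (n + e)`!%:R * (2 * n%:R + 2 + e%:R).
Proof.
have bin (a b : nat) : 'C(a + b, a)%:R = (a + b)`!%:R / (a`!%:R * b`!%:R) :> R.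
  have f0 m : m`!%:R != 0 :> R by rewrite pnatr_eq0 -lt0n fact_gt0.
  apply: (canRL (mulfK _)); first by rewrite mulf_neq0.
  by rewrite -!natrM -[in RHS](@bin_fact (a + b) a) ?leq_addr // addKn.
have f0 m : m`!%:R != 0 :> R by rewrite pnatr_eq0 -lt0n fact_gt0.
rewrite /dim_harmonics.
have -> : (n.+1 + e.+2 - 1 = n.+1 + e.+1)%N by lia.
rewrite bin; case: n => [|n] /=.
  rewrite add1n subr0 !factS !natrM fact0 !add0n mulr0 add0r.
  have e1 : (1 + e%:R : R) != 0 by rewrite nat1r pnatr_eq0.
  by field; rewrite f0 e1.
have -> : (n.+2 + e.+2 - 3 = n + e.+1)%N by lia.
have -> : (n.+2 - 2 = n)%N by lia.
rewrite bin !addnS !addSn !factS !natrM.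
have e1 : (1 + e%:R : R) != 0 by rewrite nat1r pnatr_eq0.
have n1 : (1 + n%:R : R) != 0 by rewrite nat1r pnatr_eq0.
have n2 : (2 + n%:R : R) != 0 by rewrite -natrD pnatr_eq0.
by field; rewrite !f0 n1 n2 e1.
Qed.

(** The dimension identity matching the way in which differentiation, from
    dimension [d] to [d + 2], rescales the norms of Gegenbauer polynomials. *)
Lemma dim_harmonics_rec e n :
  dim_harmonics R e.+2 n.+1 * n.+1%:R * (n + e.+1)%:R =
  e.+1%:R * e.+2%:R * dim_harmonics R e.+4 n.
Proof.
have f0 m : m`!%:R != 0 :> R by rewrite pnatr_eq0 -lt0n fact_gt0.
case: n => [|n].
  have := dim_harmonicsE e 0; rewrite factS fact0 muln1 mulr1 add0n mulr0 add0r.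
  rewrite mulrC => /(mulfI (f0 _)) ->.
  by rewrite /dim_harmonics bin0 subr0 add0n; ring.
have h1 := dim_harmonicsE e n.+1; have h2 := dim_harmonicsE e.+2 n.
apply: (mulfI (f0 n.+1)); apply: (mulfI (f0 e)).
transitivity ((dim_harmonics R e.+2 n.+2 * (n.+2)`!%:R * e`!%:R) *
   (n.+1 + e.+1)%:R); first by rewrite (factS n.+1) natrM; ring.
transitivity (dim_harmonics R e.+4 n.+1 * (n.+1)`!%:R * (e.+2)`!%:R); last first.
  by rewrite (factS e.+1) (factS e) !natrM; ring.
by rewrite h1 h2 !addnS !addSn !factS !natrM; ring.
Qed.

End GegenbauerPolynomial.

(** * Integrals and limits on an interval *)

Section Calculus.
Context {R : realType}.
Local Notation mu := (@lebesgue_measure R).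
Implicit Types (f g F : R -> R) (a b c x y : R).

Lemma dominated_integrable f g (D : set R) : measurable D ->
  measurable_fun D f -> (forall x, D x -> `|f x| <= g x) ->
  mu.-integrable D (EFin \o g) -> mu.-integrable D (EFin \o f).
Proof.
move=> mD mf fg; apply: le_integrable => //; first exact/measurable_EFinP.
by move=> x /fg /= fgx; rewrite lee_fin (le_trans fgx) // ler_norm.
Qed.

Lemma integrable_add f g (D : set R) : measurable D ->
  mu.-integrable D (EFin \o f) -> mu.-integrable D (EFin \o g) ->
  mu.-integrable D (EFin \o (fun x => f x + g x)).
Proof. by move=> mD intf intg; exact: (@integrableD _ _ R mu D mD _ _ intf intg). Qed.

Lemma integrable_scale f (k : R) (D : set R) : measurable D ->
  mu.-integrable D (EFin \o f) ->
  mu.-integrable D (EFin \o (fun x => k * f x)).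
Proof. by move=> mD intf; exact: (@integrableZl _ _ R mu D mD k _ intf). Qed.

Lemma integrable_cst (k : R) a b :
  mu.-integrable `[a, b] (EFin \o (fun=> k : R)).
Proof.
apply: continuous_compact_integrable; first exact: segment_compact.
by move=> x; exact: cvg_cst.
Qed.

Lemma integrable_sub_itv f a b c d : a <= c -> d <= b ->
  mu.-integrable `[a, b] (EFin \o f) -> mu.-integrable `[c, d] (EFin \o f).
Proof.
move=> ac db; apply: integrableS => //.
by apply: subset_itvScc; rewrite bnd_simp.
Qed.

Lemma continuous_tail_integral f a b : a <= b ->
  mu.-integrable `[a, b] (EFin \o f) ->
  {within `[a, b], continuous (fun y => \int[mu]_(x in `[y, b]) f x)}.
Proof.
move=> ab intf.
have c1 : {within `[a, b], continuous (fun y => \int[mu]_(x in `[a, b]) f x -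
    parameterized_integral mu a y f)}.
  have c2 := parameterized_integral_continuous ab intf.
  by move=> x; apply: cvgB; [exact: cvg_cst|exact: c2].
apply: (subspace_eq_continuous _ c1) => y; rewrite inE /= in_itv /= => /andP[ay yb].
rewrite /from_subspace /parameterized_integral Rintegral_itvB ?bnd_simp //.
rewrite Rintegral_itv_obnd_cbnd //; apply: integrableS intf => //.
by apply: subset_itvr; rewrite bnd_simp.
Qed.

(** The usual primitive theorem asks for an integrand that is continuous up to
    the endpoints; integrability is enough, since the indefinite integral of
    an integrable function is continuous, so that its difference with [F] is
    continuous with zero derivative inside. *)
Lemma improper_FTC2 f F a b : a <= b ->
  {within `[a, b], continuous F} ->
  (forall x, a < x < b -> is_derive x 1 F (f x)) ->
  (forall x, a < x < b -> {for x, continuous f}) ->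
  mu.-integrable `[a, b] (EFin \o f) ->
  \int[mu]_(x in `[a, b]) f x = F b - F a.
Proof.
rewrite le_eqVlt => /predU1P[-> _ _ _ _|ab cF dF cf intf].
  by rewrite set_itv1 Rintegral_set1 subrr.
pose G x := parameterized_integral mu a x f.
have cG : {within `[a, b], continuous G}.
  exact: parameterized_integral_continuous (ltW ab) intf.
have dG x : a < x < b -> is_derive x 1 G (f x).
  move=> /andP[ax xb].
  have [|d1 d2] := continuous_FTC1_closed xb intf ax; first by apply: cf; rewrite ax.
  by apply: DeriveDef => //; rewrite -derive1E.
have [||c _] := @MVT R (F \- G) (fun=> 0) a b ab.
- move=> x; rewrite in_itv /= => xab.
  have := is_deriveB (dF x xab) (dG x xab); rewrite subrr; exact.
- by move=> x; apply: cvgB; [exact: cF|exact: cG].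
rewrite mul0r => /eqP; rewrite subr_eq0 => /eqP /= FG.
have Ga : G a = 0 by rewrite /G /parameterized_integral set_itv1 Rintegral_set1.
move: FG; rewrite Ga subr0 => <-; rewrite opprB addrCA subrr addr0.
by [].
Qed.

(** If the full integral is finite this is the continuity of the indefinite
    integral; if it is infinite, monotone convergence along [b - 1 / n] makes the
    truncated integrals unbounded. *)
Lemma ge0_integral_cvg_at_left f a b : a < b ->
  measurable_fun `[a, b] f -> (forall x, a <= x < b -> 0 <= f x) ->
  (\int[mu]_(x in `[a, y]) (f x)%:E)%E @[y --> b^'-] -->
  (\int[mu]_(x in `[a, b]) (f x)%:E)%E.
Proof.
move=> ab mf f0.
have m1 y : (y <= b)%R -> measurable_fun `[a, y] (fun x => (f x)%:E).
  move=> yb; apply/measurable_EFinP; apply: measurable_funS mf => //.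
  by apply: subset_itvl; rewrite bnd_simp.
have m2 : measurable_fun `[a, b[ (fun x => (f x)%:E).
  by apply/emeasurable_fun_itv_bndo_bndcP; exact: m1.
rewrite -integral_itv_bndo_bndc //.
set L := (\int[mu]_(x in `[a, b[) _)%E.
have L0 : (0 <= L)%E.
  by apply: integral_ge0 => x /=; rewrite in_itv /= lee_fin => /f0.
have [Loo|Lfin] := eqVneq L +oo%E; last first.
  have intf : mu.-integrable `[a, b] (EFin \o f).
    apply/integrableP; split; first exact: m1.
    rewrite -integral_itv_bndo_bndc; last exact: measurableT_comp.
    under eq_integral => x.
      rewrite inE /= in_itv /= => /f0 fx0; rewrite ger0_norm //.
      over.
    by rewrite -/L ltey.
  have := parameterized_integral_cvg_at_left ab intf.
  move=> /(cvg_EFin _) h.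
  have -> : L = (parameterized_integral mu a b f)%:E.
    rewrite /L integral_itv_bndo_bndc // /parameterized_integral /Rintegral.
    by rewrite fineK //; exact: integrable_fin_num.
  apply: h; apply: filterS (nbhs_left_le b) => y yb.
  by apply: integrable_fin_num => //; exact: integrable_sub_itv intf.
rewrite Loo; apply/cvgeyPge => A.
pose I n := `[a, b - n.+1%:R^-1]%classic : set R.
have bI : `[a, b[%classic = \bigcup_n I n by rewrite itv_bnd_open_bigcup.
have nI : nondecreasing_seq I.
  move=> m n mn; apply/subsetPset; apply: subset_itvl.
  by rewrite bnd_simp lerB // lef_pV2 ?posrE // ler_nat.
have Ib n : (b - n.+1%:R^-1 <= b)%R by rewrite lerBlDr lerDl.
have cI : (\int[mu]_(x in I n) (f x)%:E)%E @[n --> \oo] --> +oo%E.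
  rewrite -Loo /L bI; apply: ge0_nondecreasing_set_cvg_integral => //.
  - by move=> n; exact: measurable_itv.
  - by move=> n; exact: m1.
  - move=> n x; rewrite /I /= in_itv /= lee_fin => /andP[ax xb].
    by apply: f0; rewrite ax (le_lt_trans xb) // ltrBlDr ltrDl.
have [n _ /(_ n (leqnn n)) /= An] := (cvgeyPge _).1 cI A.
near=> y; apply: (le_trans An); apply: ge0_subset_integral => //.
- exact: measurable_itv.
- by apply: m1; near: y; exact: nbhs_left_le.
- move=> x /=; rewrite in_itv /= lee_fin => /andP[ax xy]; apply: f0.
  by rewrite ax (le_lt_trans xy) //; near: y; exact: nbhs_left_lt.
- apply: subset_itvl; rewrite bnd_simp; near: y; apply: nbhs_left_ge.
  by rewrite ltrBlDr ltrDl.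
Unshelve. all: by end_near. Qed.

Lemma integral_funrpos_fin_num f a b c M : a < c < b ->
  measurable_fun `[a, b] f ->
  mu.-integrable `[a, c] (EFin \o f) ->
  (forall x, c <= x < b -> f x <= M) ->
  (\int[mu]_(x in `[a, b]) ((f^\+)%R x)%:E)%E \is a fin_num.
Proof.
move=> /andP[ac cb] mf intf fM; have ab := lt_trans ac cb.
have mfp : measurable_fun `[a, b[ (f^\+)%R.
  by apply/measurable_fun_itv_bndo_bndcP; exact: measurable_funrpos.
rewrite -integral_itv_bndo_bndc; last exact/measurable_EFinP.
apply: integrable_fin_num => //.
pose h x := `|(f \_ `[a, c]) x| + `|M|.
apply: (@dominated_integrable _ h) => //.
- move=> x /=; rewrite in_itv /= => /andP[ax xb].
  rewrite (ger0_norm (funrpos_ge0 _ _)) /h patchE.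
  rewrite /funrpos; case: ifPn => [_|].
    by rewrite ge_max addr_ge0 // andbT ler_wpDr // ler_norm.
  rewrite notin_setE /= in_itv /= ax /= => /negP; rewrite -ltNge => cx.
  rewrite normr0 add0r ge_max normr_ge0 andbT.
  by rewrite (le_trans (fM _ _)) ?ler_norm // (ltW cx).
- apply: integrable_add => //; last first.
    apply: integrableS (integrable_cst `|M| a b) => //.
    by apply: subset_itvl; rewrite bnd_simp.
  apply: integrable_norm.
  rewrite -restrict_EFin; apply/integrable_restrict => //.
  by apply: integrableS intf => //; exact: measurableI.
Qed.

(** Truncated integrals converge in [\bar R] as soon as the integrand is bounded
    on one side near the endpoint: then one of its positive and negative parts
    has a finite integral, so that their limits can be subtracted. *)
Lemma integral_cvg_at_left f a b c M : a < c < b ->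
  measurable_fun `[a, b] f ->
  mu.-integrable `[a, c] (EFin \o f) ->
  (forall x, c <= x < b -> f x <= M) \/ (forall x, c <= x < b -> - M <= f x) ->
  (\int[mu]_(x in `[a, y]) (f x)%:E)%E @[y --> b^'-] -->
  (\int[mu]_(x in `[a, b]) (f x)%:E)%E.
Proof.
move=> acb mf intf fM; have /andP[ac cb] := acb; have ab := lt_trans ac cb.
have mfp : measurable_fun `[a, b] (f^\+)%R by exact: measurable_funrpos.
have mfn : measurable_fun `[a, b] (f^\-)%R by exact: measurable_funrneg.
have E y : (\int[mu]_(x in `[a, y]) (f x)%:E =
    \int[mu]_(x in `[a, y]) ((f^\+)%R x)%:E -
    \int[mu]_(x in `[a, y]) ((f^\-)%R x)%:E)%E.
  rewrite integralE; congr (_ - _)%E; apply: eq_integral => x _.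
    by rewrite funeposE /funrpos EFin_max.
  by rewrite funenegE /funrneg EFin_max.
rewrite E; under eq_fun do rewrite E.
apply: cvgeB; last 2 first.
- by apply: ge0_integral_cvg_at_left => // x _; exact: funrpos_ge0.
- by apply: ge0_integral_cvg_at_left => // x _; exact: funrneg_ge0.
case: fM => fM.
  by rewrite fin_num_adde_defr //; exact: (integral_funrpos_fin_num acb mf intf fM).
rewrite fin_num_adde_defl // fin_numN.
have -> : (f^\- = (\- f)^\+)%R by rewrite funrposN.
apply: (integral_funrpos_fin_num (M := M) acb).
- exact: measurableT_comp.
- have := integrable_scale (-1) (measurable_itv _) intf.
  by apply: eq_integrable => // x _ /=; rewrite mulN1r.
- by move=> x /fM; rewrite lerNl.
Qed.
End Calculus.

Section Limits.
Context {R : realType}.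

Lemma within_continuous_itvco (f : R -> R) (a c : R) :
  (forall b, a <= b -> b < c -> {within `[a, b], continuous f}) ->
  {within `[a, c[, continuous f}.
Proof.
move=> cf; apply/subspace_continuousP => x /=; rewrite in_itv /= => /andP[ax xc].
pose b := (x + c) / 2.
have xb : x < b by rewrite /b; lra.
have bc : b < c by rewrite /b; lra.
have ab : a <= b by rewrite (le_trans ax) // ltW.
have /subspace_continuousP /(_ x) := cf b ab bc.
rewrite /= in_itv /= ax (ltW xb) => /(_ isT) h; apply: cvg_trans h.
apply: cvg_app => A hA; apply: filterS2 (lt_nbhsl xb) hA => y yb hy.
rewrite /= in_itv /= => /andP[ay _]; apply: hy.
by rewrite /= in_itv /= ay ltW.
Qed.

Lemma at_left_itvco (P : set R) (b c0 : R) : c0 < b ->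
  (\forall x \near b^'-, P x) ->
  exists c, [/\ c0 <= c, c < b & forall x, c <= x < b -> P x].
Proof.
move=> c0b [e /= e0 hP].
have [c [c1 c2 c3]] : exists c, [/\ c0 <= c, c < b & b - e < c].
  exists (Num.max c0 (b - e / 2)); split; first by rewrite le_max lexx.
    by rewrite gt_max c0b /=; lra.
  by rewrite lt_max; apply/orP; right; lra.
exists c; split => // x /andP[cx xb]; apply: hP => //=.
by rewrite gtr0_norm ?subr_gt0 //; lra.
Qed.

(** What a limit in [\bar R] leaves of boundedness; [integral_cvg_at_left] needs
    no more. *)
Lemma cvg_at_left_one_sided (f : R -> \bar R) (r : R -> R) (b c0 : R) : c0 < b ->
  (forall x, c0 <= x < b -> f x = (r x)%:E) -> f x @[x --> b^'-] --> f b ->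
  exists c K, [/\ c0 <= c, c < b, 0 <= K &
   (forall x, c <= x < b -> - K <= r x) \/ (forall x, c <= x < b -> r x <= K)].
Proof.
move=> c0b fr; case: (f b) => [l|/=|/=] fl.
- have fr' : \forall x \near b^'-, f x = (r x)%:E.
    near=> x; apply: fr; apply/andP; split; near: x;
      [exact: nbhs_left_ge|exact: nbhs_left_lt].
  have rl : r x @[x --> b^'-] --> l.
    have h : (r x)%:E @[x --> b^'-] --> l%:E.
      by apply: cvg_trans fl; exact: near_eq_cvg.
    exact: (fine_cvg h).
  have : \forall x \near b^'-, (f x >= (l - 1)%:E)%E.
    near=> x; rewrite (near fr' x) // lee_fin; near: x.
    by apply: (cvgr_ge _ rl); lra.
  move=> /(at_left_itvco c0b)[c [c1 c2 hc]].
  exists c, (`|l| + 1); split => //.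
  left=> x /andP[cx xb]; have := hc x; rewrite cx xb => /(_ isT).
  rewrite fr ?(le_trans c1) // lee_fin; apply: le_trans.
  by have := ler_norm (- l); rewrite normrN; lra.
- have : \forall x \near b^'-, (f x >= 0%:E)%E by apply: (cvgeyPge _).1 fl 0.
  move=> /(at_left_itvco c0b)[c [c1 c2 hc]].
  exists c, 0; split => //; left=> x /andP[cx xb]; have := hc x.
  by rewrite cx xb fr ?(le_trans c1) // oppr0 lee_fin; apply.
- have : \forall x \near b^'-, (f x <= 0%:E)%E by apply: (cvgeNyPle _).1 fl 0.
  move=> /(at_left_itvco c0b)[c [c1 c2 hc]].
  exists c, 0; split => //; right=> x /andP[cx xb]; have := hc x.
  by rewrite cx xb fr ?(le_trans c1) // lee_fin; apply.
Unshelve. all: by end_near. Qed.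

End Limits.

(** * The weight *)

Section Weight.
Context {R : realType}.
Local Notation mu := (@lebesgue_measure R).
Implicit Types (f g F : R -> R) (a b c d x y : R) (V S : {poly R}).

Lemma measurable_horner S (D : set R) : measurable_fun D (horner S).
Proof.
apply: measurable_funTS; apply: continuous_measurable_fun.
exact: continuous_horner.
Qed.

Lemma integrable_mul_continuous f g c d :
  {within `[c, d], continuous f} -> mu.-integrable `[c, d] (EFin \o g) ->
  mu.-integrable `[c, d] (EFin \o (fun x => f x * g x)).
Proof.
move=> cf intg.
apply: (@integrableMr _ _ R mu _ (measurable_itv _) f _ _ _ intg).
  by apply: subspace_continuous_measurable_fun.
have /compact_bounded[M [_ mrt]] :=
  continuous_compact cf (@segment_compact _ c d).
by exists M; split; rewrite ?num_real // => ? ? ? ?; exact: mrt.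
Qed.

Lemma onem_sqr_gt0 x : -1 < x < 1 -> 0 < 1 - x ^+ 2.
Proof. by nra. Qed.

Lemma onem_sqr_ge0 x : -1 <= x <= 1 -> 0 <= 1 - x ^+ 2.
Proof. by nra. Qed.

Lemma gweight_ge0 a x : 0 <= gweight a x.
Proof. exact: powR_ge0. Qed.

Lemma gweight_gt0 a x : -1 < x < 1 -> 0 < gweight a x.
Proof. by move=> /onem_sqr_gt0 ?; exact: powR_gt0. Qed.

Lemma gweight_le1 a x : 0 < a -> -1 <= x <= 1 -> gweight a x <= 1.
Proof.
move=> a0 x1; apply: (@le_trans _ _ (1 `^ a)); last by rewrite powR1.
by rewrite /gweight ge0_ler_powR ?nnegrE ?onem_sqr_ge0 ?(ltW a0) //; nra.
Qed.

Lemma gweight_boundary a : a != 0 -> gweight a (-1 : R) = 0 /\ gweight a (1 : R) = 0.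
Proof. by move=> a0; rewrite /gweight sqrrN expr1n subrr powR0. Qed.

Lemma gweightS a x : 0 < a -> -1 <= x <= 1 ->
  (1 - x ^+ 2) * gweight (a - 1) x = gweight a x.
Proof. by move=> a0 /onem_sqr_ge0 x0; rewrite /gweight mulr_powRB1. Qed.

Lemma gweightV a x : gweight (- a) x = (gweight a x)^-1.
Proof. by rewrite /gweight powRN. Qed.

Lemma measurable_gweight a (D : set R) : measurable_fun D (gweight a).
Proof.
apply: measurable_funTS.
apply: (measurableT_comp (measurable_powR a)).
rewrite (_ : (fun _ => _) = horner (1 - 'X ^+ 2)).
  exact: measurable_horner.
by apply/funext => x; rewrite !hornerE.
Qed.

Lemma is_derive_gweight a x : -1 < x < 1 ->
  is_derive x 1 (gweight a) (- (2 * a * x * gweight (a - 1) x)).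
Proof.
move=> /onem_sqr_gt0 x0.
have := is_derive_poly (1 - 'X ^+ 2) x.
have := @is_derive1_powR R a (1 - x ^+ 2) x0 => h1 h2.
have h : is_derive x 1 ((@powR R ^~ a) \o horner (1 - 'X ^+ 2))
    (a * (1 - x ^+ 2) `^ (a - 1) * (1 - 'X ^+ 2)^`().[x]).
  by apply: is_derive1_comp; rewrite !hornerE.
have -> : @gweight R a = (@powR R ^~ a) \o horner (1 - 'X ^+ 2).
  by apply/funext => y; rewrite /= !hornerE.
apply: is_derive_eq h _.
rewrite derivB derivC derivXn !hornerE /= /gweight; ring.
Qed.

Lemma continuous_gweight_in a x : -1 < x < 1 -> {for x, continuous (gweight a)}.
Proof.
move=> /(is_derive_gweight a) h.
by apply/differentiable_continuous/derivable1_diffP; exact: ex_derive.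
Qed.

(** Only the endpoints are not covered by differentiability; there [1 - x^2]
    tends to [0] from the right. *)
Lemma continuous_gweight a : 0 < a ->
  {within `[-1, 1], continuous (gweight a : R -> R)}.
Proof.
move=> a0; have [b1 b2] := gweight_boundary (lt0r_neq0 a0).
have N11 : -1 < 1 :> R by rewrite ltrN10 || lra.
pose h := horner (1 - 'X ^+ 2 : {poly R}).
have hE x : h x = 1 - x ^+ 2 by rewrite /h !hornerE.
have ga : @gweight R a = (@powR R ^~ a) \o h by apply/funext => x; rewrite /= hE.
have h_cvg0 (F : set_system R) : ProperFilter F -> h x @[x --> F] --> (0 : R) ->
    (\forall x \near F, 0 < h x) -> gweight a x @[x --> F] --> (0 : R).
  move=> FF hF hpos; rewrite ga; apply: cvg_comp (powR_cvg0 a0) => A /= A0.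
  by have /= hA := hF _ A0; apply: filterS2 hpos hA => x h0; apply.
apply/continuous_within_itvP => //; split.
- by move=> x; rewrite in_itv /=; exact: continuous_gweight_in.
- rewrite b1; apply: h_cvg0.
    have -> : 0 = h (-1) by rewrite hE; ring.
    by apply: cvg_at_right_filter; exact: continuous_horner.
  near=> x; rewrite hE onem_sqr_gt0 //; apply/andP; split; near: x.
    exact: nbhs_right_gt.
  exact: nbhs_right_lt.
- rewrite b2; apply: h_cvg0.
    have -> : 0 = h 1 by rewrite hE; ring.
    by apply: cvg_at_left_filter; exact: continuous_horner.
  near=> x; rewrite hE onem_sqr_gt0 //; apply/andP; split; near: x.
    exact: nbhs_left_gt.
  exact: nbhs_left_lt.
Unshelve. all: by end_near. Qed.

Lemma is_derive_poly_gweight V a x : 0 < a -> -1 < x < 1 ->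
  is_derive x 1 (fun y => V.[y] * gweight a y)
    (((1 - x ^+ 2) * V^`().[x] - 2 * a * x * V.[x]) * gweight (a - 1) x).
Proof.
move=> a0 x1.
have h : is_derive x 1 (horner V * gweight a)
    (V.[x] *: - (2 * a * x * gweight (a - 1) x) + gweight a x *: V^`().[x]).
  by apply: is_deriveM; exact: is_derive_gweight.
apply: is_derive_eq h _.
rewrite -(gweightS a0); last by case/andP: x1 => /ltW -> /ltW ->.
rewrite /GRing.scale /=; ring.
Qed.

Lemma continuous_poly_gweight V a c d : 0 < a -> -1 <= c -> d <= 1 ->
  {within `[c, d], continuous (fun y => V.[y] * gweight a y)}.
Proof.
move=> a0 c1 d1; have cdD : `[c, d] `<=` `[-1, 1].
  by apply: subset_itvScc; rewrite bnd_simp.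
apply: (continuous_subspaceW cdD).
have cV : {within `[-1, 1], continuous (horner V)}.
  by apply: continuous_subspaceT; exact: continuous_horner.
by move=> x; apply: cvgM; [exact: cV|exact: continuous_gweight].
Qed.

Lemma continuous_horner_mul_in V f x : {for x, continuous f} ->
  {for x, continuous (fun y => V.[y] * f y)}.
Proof. by move=> cf; apply: cvgM => //; exact: continuous_horner. Qed.

(** On [[-t, t]] the integral of [(x (1 - x^2)^a)' = (1 + 2a) (1 - x^2)^a - 2a
    (1 - x^2)^(a - 1)] is nonnegative, which bounds the integral of
    [(1 - x^2)^(a - 1)] independently of [t < 1]. *)
Lemma integral_gweight_sym_le a t : 0 < a -> 0 <= t < 1 ->
  \int[mu]_(x in `[- t, t]) gweight (a - 1) x <= (1 + 2 * a) / a.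
Proof.
move=> a0 /andP[t0 t1].
have tt : - t <= t by lra.
have cw : {within `[- t, t], continuous (gweight (a - 1) : R -> R)}.
  apply: continuous_in_subspaceT => x; rewrite inE /= in_itv /= => /andP[tx xt].
  by apply: continuous_gweight_in; apply/andP; split; lra.
have iw := continuous_compact_integrable (@segment_compact _ (- t) t) cw.
have cp : {within `[- t, t], continuous (gweight a : R -> R)}.
  apply: continuous_subspaceW (continuous_gweight a0).
  by apply: subset_itvScc; rewrite bnd_simp; lra.
have ip := continuous_compact_integrable (@segment_compact _ (- t) t) cp.
pose F y := 'X.[y] * gweight a y : R.
pose f y := (1 + 2 * a) * gweight a y - 2 * a * gweight (a - 1) y.
have i1 := integrable_scale (1 + 2 * a) (measurable_itv _) ip.
have i2 := integrable_scale (2 * a) (measurable_itv _) iw.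
have FE : \int[mu]_(x in `[- t, t]) f x = F t - F (- t).
  apply: improper_FTC2 => //.
  - by apply: continuous_poly_gweight => //; lra.
  - move=> x /andP[x1 x2]; apply: is_derive_eq.
      by apply: is_derive_poly_gweight => //; apply/andP; split; lra.
    rewrite derivX !hornerE /f -(gweightS a0); last by apply/andP; split; lra.
    ring.
  - move=> x /andP[x1 x2]; have x3 : -1 < x < 1 by apply/andP; split; lra.
    by apply: cvgB; apply: cvgM;
      [exact: cvg_cst|exact: continuous_gweight_in|exact: cvg_cst|
       exact: continuous_gweight_in].
  - exact: (@integrableB _ _ R mu _ (measurable_itv _) _ _ i1 i2).
have : 0 <= \int[mu]_(x in `[- t, t]) f x.
  rewrite FE /F !hornerX /gweight sqrrN.
  by rewrite -mulrBl mulr_ge0 ?powR_ge0 //; lra.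
rewrite /f RintegralB // !RintegralZl // subr_ge0.
have p2 : \int[mu]_(x in `[- t, t]) gweight a x <= 2.
  apply: (@le_trans _ _ (\int[mu]_(x in `[- t, t]) (1 : R))).
    apply: le_Rintegral => //; first exact: integrable_cst.
    move=> x /=; rewrite in_itv /= => /andP[x1 x2].
    by apply: gweight_le1 => //; apply/andP; split; lra.
  rewrite Rintegral_cst // mul1r /= lebesgue_measure_itv /= lte_fin.
  by case: ifP => _ /=; lra.
move=> h; rewrite ler_pdivlMr //.
have : (1 + 2 * a) * \int[mu]_(x in `[- t, t]) gweight a x <= (1 + 2 * a) * 2.
  by rewrite ler_wpM2l //; lra.
by move: h; set A := Rintegral _ _ _; set B := Rintegral _ _ _; lra.
Qed.

(** Monotone convergence along the intervals [[- t, t]] with [t = 1 - 1 / n]. *)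
Lemma integrable_gweight a : 0 < a ->
  mu.-integrable `[-1, 1] (EFin \o (gweight (a - 1) : R -> R)).
Proof.
move=> a0.
have mw D : measurable_fun D (fun x : R => (gweight (a - 1) x)%:E).
  by apply/measurable_EFinP; exact: measurable_gweight.
apply/integrableP; split; first exact: mw.
under eq_integral do rewrite /= ger0_norm ?gweight_ge0 //.
rewrite -integral_itv_bndo_bndc // -integral_itv_obnd_cbnd //.
pose t n : R := 1 - n.+1%:R^-1.
have t01 n : 0 <= t n < 1.
  have n0 : 0 < n.+1%:R^-1 :> R by rewrite invr_gt0.
  have n1 : n.+1%:R^-1 <= 1 :> R by rewrite invf_le1 // ler1n.
  by rewrite /t subr_ge0 n1 gtrBl n0.
pose I n := `[- t n, t n]%classic.
have bI : `]-1, 1[%classic = \bigcup_n I n.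
  apply/seteqP; split=> x /=; rewrite in_itv /=.
    move=> /andP[x1 x2].
    have y0 : 0 < Num.min (1 - x) (x + 1) by rewrite lt_min; lra.
    have [n _ /(_ n (leqnn n)) /= hn] := near_infty_natSinv_lt (PosNum y0).
    move: hn; rewrite lt_min => /andP[h1 h2].
    exists n => //; rewrite /I /t /= in_itv /=; move: h1 h2.
    by set u := n.+1%:R^-1 => h1 h2; apply/andP; split; lra.
  move=> [n _]; rewrite /I /= in_itv /=; case/andP: (t01 n) => ? ? /andP[? ?].
  by apply/andP; split; lra.
have cI : (\int[mu]_(x in I n) (gweight (a - 1) x)%:E)%E @[n --> \oo] -->
    (\int[mu]_(x in `](-1)%R, 1%R[) (gweight (a - 1) x)%:E)%E.
  rewrite bI; apply: ge0_nondecreasing_set_cvg_integral.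
  - move=> m n mn; apply/subsetPset; apply: subset_itvScc;
      by rewrite bnd_simp ?lerN2 lerB // lef_pV2 ?posrE // ler_nat.
  - by move=> n; exact: measurable_itv.
  - by move=> n; exact: mw.
  - by move=> n x _; rewrite lee_fin gweight_ge0.
apply: (@le_lt_trans _ _ ((1 + 2 * a) / a)%:E); last exact: ltry.
apply: cvge_le cI.
near=> n; have := integral_gweight_sym_le a0 (t01 n).
have cw : {within I n, continuous (gweight (a - 1) : R -> R)}.
  apply: continuous_in_subspaceT => x; rewrite inE /I /= in_itv /=.
  move=> /andP[tx xt]; case/andP: (t01 n) => t0 t1.
  by apply: continuous_gweight_in; apply/andP; split; lra.
have iw := continuous_compact_integrable (@segment_compact _ _ _) cw.
by rewrite -lee_fin /Rintegral fineK //; exact: integrable_fin_num.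
Unshelve. all: by end_near. Qed.

End Weight.

(** * Integrals and norms of Gegenbauer polynomials *)

Section GegenbauerIntegrals.
Context {R : realType}.
Local Notation mu := (@lebesgue_measure R).
Implicit Types (a b c d x y lam : R) (V S : {poly R}).

Lemma integrable_poly_gweight S a c d : 0 < a -> -1 <= c -> d <= 1 ->
  mu.-integrable `[c, d] (EFin \o (fun x => S.[x] * gweight (a - 1) x)).
Proof.
move=> a0 c1 d1; apply: integrable_mul_continuous.
  by apply: continuous_subspaceT; exact: continuous_horner.
exact: integrable_sub_itv c1 d1 (integrable_gweight a0).
Qed.

(** The relations between integrals of Gegenbauer polynomials come from this
    identity by a choice of [V], the primitive [V (1 - x^2)^a] vanishing at both
    ends of [[-1, 1]]. *)
Lemma integral_poly_gweight V S a c d : 0 < a -> -1 <= c -> c <= d -> d <= 1 ->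
  (forall x, (1 - x ^+ 2) * V^`().[x] - 2 * a * x * V.[x] = S.[x]) ->
  \int[mu]_(x in `[c, d]) (S.[x] * gweight (a - 1) x) =
  V.[d] * gweight a d - V.[c] * gweight a c.
Proof.
move=> a0 c1 cd d1 VS.
apply: (improper_FTC2 (F := fun x => V.[x] * gweight a x)) => //.
- exact: continuous_poly_gweight.
- move=> x /andP[cx xd]; rewrite -VS; apply: is_derive_poly_gweight => //.
  by apply/andP; split; lra.
- move=> x /andP[cx xd]; apply: continuous_horner_mul_in.
  by apply: continuous_gweight_in; apply/andP; split; lra.
- exact: integrable_poly_gweight.
Qed.

(** On [[1/2, 1]] one has [1 <= 4 a x], so that the weight is at most twice the
    opposite of the derivative of [(1 - x^2)^a]. *)
Lemma integral_gweight_right_le a y : 2^-1 <= a -> 2^-1 <= y -> y <= 1 ->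
  \int[mu]_(x in `[y, 1]) gweight (a - 1) x <= 2 * gweight a y.
Proof.
move=> ha y2 y1; have a0 : 0 < a by lra.
have y1' : -1 <= y by lra.
have S1 := @integral_poly_gweight (- 1) ((2 * a) *: 'X) a y 1 a0 y1' y1 (lexx _).
rewrite -[leRHS](_ : 2 * \int[mu]_(x in `[y, 1])
    (((2 * a) *: 'X).[x] * gweight (a - 1) x) = _); last first.
  rewrite S1.
    by rewrite !hornerE (gweight_boundary (lt0r_neq0 a0)).2; ring.
  by move=> x; rewrite derivN derivC !hornerE; ring.
have i1 := @integrable_poly_gweight ((2 * a) *: 'X) a y 1 a0 y1' (lexx _).
rewrite -RintegralZl //; apply: le_Rintegral => //.
- exact: integrable_sub_itv y1' (lexx _) (integrable_gweight a0).
- exact: (integrable_scale 2 (measurable_itv _) i1).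
move=> x /=; rewrite in_itv /= !hornerE /= => /andP[yx x1].
rewrite -[leLHS]mul1r ler_wpM2r ?gweight_ge0 //; nra.
Qed.

Lemma integral_gweight_left_le a y : 2^-1 <= a -> -1 <= y -> y <= - 2^-1 ->
  \int[mu]_(x in `[-1, y]) gweight (a - 1) x <= 2 * gweight a y.
Proof.
move=> ha y1 y2; have a0 : 0 < a by lra.
have y1' : y <= 1 by lra.
have S1 := @integral_poly_gweight 1 (- ((2 * a) *: 'X)) a (-1) y a0 (lexx _) y1 y1'.
rewrite -[leRHS](_ : 2 * \int[mu]_(x in `[-1, y])
    ((- ((2 * a) *: 'X)).[x] * gweight (a - 1) x) = _); last first.
  rewrite S1.
    by rewrite !hornerE (gweight_boundary (lt0r_neq0 a0)).1; ring.
  by move=> x; rewrite derivC !hornerE; ring.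
have i1 := @integrable_poly_gweight (- ((2 * a) *: 'X)) a (-1) y a0 (lexx _) y1'.
rewrite -RintegralZl //; apply: le_Rintegral => //.
- exact: integrable_sub_itv (lexx _) y1' (integrable_gweight a0).
- exact: (integrable_scale 2 (measurable_itv _) i1).
move=> x /=; rewrite in_itv /= !hornerE /= => /andP[x1 xy].
rewrite [leRHS](_ : _ = (2 * (2 * a) * - x) * gweight (a - 1) x); last by ring.
rewrite -[leLHS]mul1r ler_wpM2r ?gweight_ge0 //; nra.
Qed.

(** The integral of [2 a x (1 - x^2)^(a - 1)] over [[1/2, 1]] is the value of
    [(1 - x^2)^a] at [1/2]. *)
Lemma integral_gweight_gt0 a : 0 < a ->
  0 < \int[mu]_(x in `[-1, 1]) gweight (a - 1) x.
Proof.
move=> a0.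
have N11 : -1 <= 1 :> R by lra.
have h0 : 0 <= 2^-1 :> R by lra. have h1 : 2^-1 <= 1 :> R by lra.
have h2 : -1 <= 2^-1 :> R by lra.
have S1 := @integral_poly_gweight (- 1) ((2 * a) *: 'X) a 2^-1 1 a0 h2 h1 (lexx _).
have i1 := @integrable_poly_gweight ((2 * a) *: 'X) a 2^-1 1 a0 h2 (lexx _).
have iw := integrable_gweight a0.
have iwr := integrable_sub_itv h2 (lexx _) iw.
have pos : 0 < \int[mu]_(x in `[2^-1, 1]) gweight (a - 1) x.
  rewrite -(pmulr_rgt0 _ (_ : 0 < 2 * a)); last by rewrite mulr_gt0.
  rewrite -RintegralZl //; apply: (@lt_le_trans _ _ (gweight a 2^-1)).
    by apply: gweight_gt0; apply/andP; split; lra.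
  have -> : gweight a (2^-1 : R) =
      \int[mu]_(x in `[2^-1, 1]) (((2 * a) *: 'X).[x] * gweight (a - 1) x).
    rewrite S1.
      by rewrite !hornerE (gweight_boundary (lt0r_neq0 a0)).2; ring.
    by move=> x; rewrite derivN derivC !hornerE; ring.
  apply: le_Rintegral => //.
    exact: (integrable_scale (2 * a) (measurable_itv _) iwr).
  move=> x /=; rewrite in_itv /= !hornerE /= => /andP[x1 x2].
  by rewrite ler_wpM2r ?gweight_ge0 //; nra.
have := @Rintegral_itvB R _ (BLeft (-1)) (BRight 1) 2^-1 iw.
rewrite !bnd_simp => /(_ h2 h1) /eqP; rewrite subr_eq => /eqP ->.
rewrite Rintegral_itv_obnd_cbnd; last first.
  by apply: integrableS iwr => //; apply: subset_itvr; rewrite bnd_simp.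
by rewrite ltr_wpDr // Rintegral_ge0 // => x _; rewrite gweight_ge0.
Qed.

(** The differential equation integrated in divergence form. *)
Lemma integral_gegenbauer lam n c d : 0 <= lam -> -1 <= c -> c <= d -> d <= 1 ->
  let W := gegenbauer_poly lam n in
  n%:R * (n%:R + 2 * lam) *
    \int[mu]_(x in `[c, d]) (W.[x] * gweight (lam - 2^-1) x) =
  W^`().[c] * gweight (lam + 2^-1) c - W^`().[d] * gweight (lam + 2^-1) d.
Proof.
move=> lam0 c1 cd d1 W; have a0 : 0 < lam + 2^-1 by lra.
have -> : lam - 2^-1 = lam + 2^-1 - 1 by field.
pose S := - (n%:R * (n%:R + 2 * lam)) *: W.
have h := @integral_poly_gweight W^`() S _ _ _ a0 c1 cd d1.
rewrite -[RHS]opprB -h => [|x]; last first.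
  rewrite /S hornerZ -(gegenbauer_ode n x a0) -/W.
  by congr (_ - _ * _ * _); field.
have iW : mu.-integrable `[c, d]
    (EFin \o (fun x => W.[x] * gweight (lam + 2^-1 - 1) x)).
  exact: integrable_poly_gweight.
rewrite -[LHS]opprK -mulNr -RintegralZl //; congr (- _).
by apply: eq_Rintegral => x _; rewrite /S hornerZ mulrA.
Qed.

Lemma integral_gweight_shift lam : 0 <= lam ->
  (2 * lam + 2) * \int[mu]_(x in `[-1, 1]) gweight (lam + 1 - 2^-1) x =
  (2 * lam + 1) * \int[mu]_(x in `[-1, 1]) gweight (lam - 2^-1) x.
Proof.
move=> lam0; have a0 : 0 < lam + 2^-1 by lra.
have -> : lam - 2^-1 = lam + 2^-1 - 1 by field.
have -> : lam + 1 - 2^-1 = lam + 2^-1 by field.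
have N11 : -1 <= 1 :> R by lra.
pose S : {poly R} := (2 * lam + 2) *: (1 - 'X ^+ 2) - (2 * lam + 1)%:P.
have := @integral_poly_gweight 'X S _ _ _ a0 (lexx _) N11 (lexx _).
rewrite (gweight_boundary (lt0r_neq0 a0)).1 (gweight_boundary (lt0r_neq0 a0)).2.
rewrite !mulr0 subrr => h.
have iw := integrable_gweight a0.
have ip : mu.-integrable `[-1, 1] (EFin \o (gweight (lam + 2^-1) : R -> R)).
  apply: continuous_compact_integrable; first exact: segment_compact.
  exact: continuous_gweight.
apply/eqP; rewrite -subr_eq0 -!RintegralZl // -RintegralB //.
- rewrite -{}[X in _ == X]h => [|x]; last first.
    by rewrite derivX /S !hornerE /=; field.
  apply/eqP; apply: eq_Rintegral => x; rewrite inE /= in_itv /= => x1.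
  by rewrite -(gweightS a0 x1) /S !hornerE /=; ring.
- exact: (integrable_scale _ (measurable_itv _) ip).
- exact: (integrable_scale _ (measurable_itv _) iw).
Qed.

(** The differential equation multiplied by the polynomial and integrated by
    parts. *)
Lemma gegenbauer_sqr_norm lam n : 0 <= lam ->
  n%:R * (n%:R + 2 * lam) * \int[mu]_(x in `[-1, 1])
    ((gegenbauer_poly lam n).[x] ^+ 2 * gweight (lam - 2^-1) x) =
  \int[mu]_(x in `[-1, 1])
    ((gegenbauer_poly lam n)^`().[x] ^+ 2 * gweight (lam + 2^-1) x).
Proof.
move=> lam0; have a0 : 0 < lam + 2^-1 by lra.
have -> : lam - 2^-1 = lam + 2^-1 - 1 by field.
have N11 : -1 <= 1 :> R by lra.
set W := gegenbauer_poly lam n.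
pose S := (1 - 'X ^+ 2) * W^`() ^+ 2 - (n%:R * (n%:R + 2 * lam)) *: W ^+ 2.
have := @integral_poly_gweight (W^`() * W) S _ _ _ a0 (lexx _) N11 (lexx _).
rewrite (gweight_boundary (lt0r_neq0 a0)).1 (gweight_boundary (lt0r_neq0 a0)).2.
rewrite !mulr0 subrr => h.
have iw := integrable_gweight a0.
have ip : mu.-integrable `[-1, 1] (EFin \o (gweight (lam + 2^-1) : R -> R)).
  apply: continuous_compact_integrable; first exact: segment_compact.
  exact: continuous_gweight.
have cV V : {within `[-1, 1], continuous (fun x : R => V.[x] ^+ 2)}.
  rewrite (_ : (fun _ => _) = horner (V ^+ 2)); last first.
    by apply/funext => x; rewrite horner_exp.
  by apply: continuous_subspaceT; exact: continuous_horner.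
have iw2 := integrable_mul_continuous (cV W) iw.
have ip2 := integrable_mul_continuous (cV W^`()) ip.
apply/eqP; rewrite eq_sym -subr_eq0 -!RintegralZl // -RintegralB //; last first.
  exact: (integrable_scale _ (measurable_itv _) iw2).
rewrite -{}[X in _ == X]h => [|x]; last first.
  have /(congr1 (fun r => r * W.[x])) := gegenbauer_ode n x a0.
  rewrite -/W /S derivM !hornerE /= => ode.
  by rewrite -[RHS]addr0 -(subrr (- (n%:R * (n%:R + 2 * lam)) * W.[x] * W.[x]))
    -{1}ode; field.
apply/eqP; apply: eq_Rintegral => x; rewrite inE /= in_itv /= => x1.
by rewrite -(gweightS a0 x1) /S !hornerE /=; ring.
Qed.

(** Induction on the degree, for all dimensions at once: the derivative of the
    polynomial of degree [n + 1] in dimension [d] is a multiple of the one of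
    degree [n] in dimension [d + 2], [gegenbauer_sqr_norm] relates their norms,
    and [integral_gweight_shift] the total masses. *)
Lemma gegenbauer_norm (d n : nat) : (2 <= d)%N ->
  let lam : R := lambda_of R d in
  dim_harmonics R d n * \int[mu]_(x in `[-1, 1])
    ((gegenbauer_poly lam n).[x] ^+ 2 * gweight (lam - 2^-1) x) =
  \int[mu]_(x in `[-1, 1]) gweight (lam - 2^-1) x.
Proof.
elim: n d => [|n IH] d d2 lam.
  rewrite /dim_harmonics bin0 subr0 mul1r; apply: eq_Rintegral => x _.
  by rewrite gegenbauer0 hornerC expr1n mul1r.
case: d d2 => [|[|e]] // _ in lam *.
have lam0 : 0 <= lam by rewrite /lam /lambda_of -addn2 natrD addrK mulr_ge0.
have lamE : lam = e%:R / 2 by rewrite /lam /lambda_of -addn2 natrD addrK.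
have {IH} := IH e.+4 isT.
have -> : lambda_of R e.+4 = lam + 1.
  by rewrite lamE /lambda_of -[e.+4]addn4 natrD; field.
have h0 := integral_gweight_shift lam0.
have hn := gegenbauer_sqr_norm n.+1 lam0.
have dimE := @dim_harmonics_rec R e n.
have c0 : 0 < lam + 2^-1 by lra.
have m0 : 0 < n.+1%:R :> R by rewrite ltr0n.
set m : R := n.+1%:R in hn dimE m0 *.
set G := gegenbauer_poly (lam + 1) n.
set A := \int[mu]_(x in `[-1, 1])
  ((gegenbauer_poly lam n.+1).[x] ^+ 2 * gweight (lam - 2^-1) x) in hn *.
set E := \int[mu]_(x in _) gweight (lam - 2^-1) x in h0 *.
set C := \int[mu]_(x in `[-1, 1]) (G.[x] ^+ 2 * gweight (lam + 1 - 2^-1) x).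
set D := \int[mu]_(x in _) gweight (lam + 1 - 2^-1) x in h0 *.
move=> IH; have {}IH : dim_harmonics R e.+4 n * C = D by exact: IH.
pose kap := m * (m + 2 * lam) / (2 * lam + 1).
have {}hn : m * (m + 2 * lam) * A = kap ^+ 2 * C.
  rewrite hn /C -RintegralZl //; last first.
    have := @integrable_poly_gweight (G ^+ 2) (lam + 1 + 2^-1) (-1) 1.
    have -> : lam + 1 + 2^-1 - 1 = lam + 1 - 2^-1 by field.
    move=> /(_ _ (lexx _) (lexx _)) h.
    have -> : (fun x => G.[x] ^+ 2 * gweight (lam + 1 - 2^-1) x) =
        (fun x => (G ^+ 2).[x] * gweight (lam + 1 - 2^-1) x); last first.
      by apply: h; lra.
    by apply/funext => x; rewrite horner_exp.
  apply: eq_Rintegral => x _; rewrite deriv_gegenbauer // hornerZ -/kap -/G.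
  have -> : lam + 1 - 2^-1 = lam + 2^-1 by field.
  by ring.
have eE : e%:R = 2 * lam by rewrite lamE; field.
have {}dimE : dim_harmonics R e.+2 n.+1 * (m * (m + 2 * lam)) =
    (2 * lam + 1) * (2 * lam + 2) * dim_harmonics R e.+4 n.
  rewrite -eE mulrA; move: dimE; rewrite -/m.
  have -> : (n + e.+1)%:R = m + e%:R by rewrite addnS -addSn natrD.
  have -> : e.+1%:R = e%:R + 1 :> R by rewrite -natr1.
  have -> : e.+2%:R = e%:R + 2 :> R by rewrite -addn2 natrD.
  by [].
have m1 : m * (m + 2 * lam) != 0 by rewrite gt_eqF // mulr_gt0 // ltr_wpDr ?mulr_ge0.
have l1 : 2 * lam + 1 != 0 by rewrite gt_eqF //; lra.
apply: (mulfI l1); apply: (mulfI m1).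
transitivity (dim_harmonics R e.+2 n.+1 * (2 * lam + 1) * (m * (m + 2 * lam) * A)).
  by ring.
rewrite hn -h0 -IH /kap.
transitivity (dim_harmonics R e.+2 n.+1 * (m * (m + 2 * lam)) *
    (m * (m + 2 * lam)) / (2 * lam + 1) * C); first by field.
by rewrite dimE; field.
Qed.

End GegenbauerIntegrals.

(** * Exchanging integrals over a triangle *)

Section Triangle.
Context {R : realType}.
Local Notation mu := (@lebesgue_measure R).
Implicit Types (f g h : R -> R) (a b c x y : R).

Lemma integrable_itv_bndo_bndc (f : R -> \bar R) (a : itv_bound R) b :
  mu.-integrable [set` Interval a (BLeft b)] f <->
  mu.-integrable [set` Interval a (BRight b)] f.
Proof.
split=> /integrableP[/emeasurable_fun_itv_bndo_bndcP mf foo]; apply/integrableP.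
  split => //; rewrite -integral_itv_bndo_bndc //.
  by apply: measurableT_comp => //; apply/emeasurable_fun_itv_bndo_bndcP.
by split => //; rewrite integral_itv_bndo_bndc //; exact: measurableT_comp.
Qed.

(** As [g] need not be integrable up to [b], the exchange takes place on the
    half-open interval; the point [b] is negligible. Integrability on the
    triangle is checked in the order of integration in which the inner integral
    is the tail of [h]. *)
Lemma triangle_fubini g h a b :
  measurable_fun `[a, b] g ->
  mu.-integrable `[a, b] (EFin \o h) ->
  (forall x, a <= x < b -> mu.-integrable `[a, x] (EFin \o g)) ->
  mu.-integrable `[a, b]
    (EFin \o (fun y => g y * \int[mu]_(x in `[y, b]) `|h x|)) ->
  mu.-integrable `[a, b] (EFin \o (fun x => h x * \int[mu]_(y in `[a, x]) g y)) /\
  \int[mu]_(x in `[a, b]) (h x * \int[mu]_(y in `[a, x]) g y) =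
  \int[mu]_(y in `[a, b]) (g y * \int[mu]_(x in `[y, b]) h x).
Proof.
move=> mg inth intg intgh.
pose D := `[a, b[%classic : set R.
have mh : measurable_fun `[a, b] h.
  by move/integrableP : inth => [/measurable_EFinP].
have mgD : measurable_fun D g by exact/measurable_fun_itv_bndo_bndcP.
have mhD : measurable_fun D h by exact/measurable_fun_itv_bndo_bndcP.
pose gg := g \_ D; pose hh := h \_ D.
have mgg : measurable_fun setT gg.
  by apply/(measurable_restrictT _ _).1 => //; exact: measurable_itv.
have mhh : measurable_fun setT hh.
  by apply/(measurable_restrictT _ _).1 => //; exact: measurable_itv.
pose ind (p : R * R) : R := if (p.2 <= p.1)%R then 1 else 0.
have mind : measurable_fun setT ind.
  apply: measurable_fun_ifT => //.
  exact: (measurable_fun_ler measurable_snd measurable_fst).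
pose F (p : measurableTypeR R * measurableTypeR R) : \bar R :=
  (hh p.1 * gg p.2 * ind p)%:E.
have mF : measurable_fun setT F.
  apply/measurable_EFinP; apply: measurable_funM => //; apply: measurable_funM.
    exact: (measurableT_comp mhh measurable_fst).
  exact: (measurableT_comp mgg measurable_snd).
have intD y (k : R -> R) : a <= y < b -> mu.-integrable `[a, b] (EFin \o k) ->
    mu.-integrable `[y, b[ (EFin \o k).
  move=> /andP[ay yb]; apply: integrableS => //.
  by apply: subset_itv; rewrite bnd_simp.
have ggE y : a <= y < b -> gg y = g y.
  by move=> yab; rewrite /gg patchE mem_set //= in_itv.
have hhE x : a <= x < b -> hh x = h x.
  by move=> xab; rewrite /hh patchE mem_set //= in_itv.
have gg0 y : ~~ (a <= y < b) -> gg y = 0.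
  by move=> yab; rewrite /gg patchE memNset // /D /= in_itv /=; exact/negP.
have hh0 x : ~~ (a <= x < b) -> hh x = 0.
  by move=> xab; rewrite /hh patchE memNset // /D /= in_itv /=; exact/negP.
have Gy y (c : R) (k : R -> R) : a <= y < b ->
    mu.-integrable `[a, b] (EFin \o k) ->
    (\int[mu]_x ((k \_ D) x * c * ind (x, y))%:E =
     (c * \int[mu]_(x in `[y, b]) k x)%:E)%E.
  move=> yab intk; have intky := intD _ _ yab intk.
  rewrite -Rintegral_itv_bndo_bndc //.
  have -> : (fun x => ((k \_ D) x * c * ind (x, y))%:E) =
      (fun x => (c%:E * (EFin \o (k \_ `[y, b[)) x)%E).
    apply/funext => x; rewrite /= -EFinM; congr EFin.
    rewrite mulrAC [RHS]mulrC; congr (_ * _).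
    rewrite !patchE /ind /=; case: (leP y x) => yx.
      rewrite mulr1; congr (if _ then _ else _).
      apply/idP/idP; rewrite !inE /D /= !in_itv /= => /andP[h1 h2];
        by rewrite h2 ?yx // (le_trans _ h1) //; case/andP: yab.
    by rewrite mulr0 memNset //= in_itv /= leNgt yx.
  rewrite integralZl //; last first.
    by rewrite -restrict_EFin; apply/(integrable_mkcond _ _).1.
  rewrite EFinM; congr (_ * _)%E.
  rewrite /Rintegral fineK; last exact: integrable_fin_num.
  by rewrite [RHS]integral_mkcond restrict_EFin.
have Fx x : a <= x < b ->
    (\int[mu]_y F (x, y) = (h x * \int[mu]_(y in `[a, x]) g y)%:E)%E.
  move=> xab; have intgx := intg _ xab.
  have -> : (fun y => F (x, y)) =
      (fun y => ((h x)%:E * (EFin \o (g \_ `[a, x])) y)%E).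
    apply/funext => y; rewrite /F /= -EFinM; congr EFin.
    rewrite hhE // -mulrA; congr (_ * _).
    rewrite /gg !patchE /ind /=; case: (leP y x) => yx.
      rewrite mulr1; congr (if _ then _ else _).
      apply/idP/idP; rewrite !inE /D /= !in_itv /= => /andP[h1 h2].
        by rewrite h1.
      by rewrite h1 (le_lt_trans h2) //; case/andP: xab.
    by rewrite mulr0 memNset //= in_itv /= [_ <= x]leNgt yx andbF.
  rewrite integralZl //; last first.
    by rewrite -restrict_EFin; apply/(integrable_mkcond _ _).1.
  rewrite EFinM; congr (_ * _)%E.
  rewrite /Rintegral fineK; last exact: integrable_fin_num.
  by rewrite [RHS]integral_mkcond restrict_EFin.
have intgh' : mu.-integrable D
    (EFin \o (fun y => g y * \int[mu]_(x in `[y, b]) `|h x|)).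
  exact/integrable_itv_bndo_bndc.
have intF : (mu \x mu)%E.-integrable setT F.
  apply/(@integrable21ltyP _ _ _ _ R mu mu F mF).
  have -> : (fun y => \int[mu]_x `|F (x, y)|)%E =
      ((fun y => `|(g y * \int[mu]_(x in `[y, b]) `|h x|)%:E|)%E \_ D).
    apply/funext => y; rewrite patchE; case: ifPn.
      rewrite inE /D /= in_itv /= => yab.
      have := Gy y `|gg y| (fun x => `|h x|) yab (integrable_norm inth).
      rewrite /= normrM ggE // (ger0_norm (Rintegral_ge0 _ _)) // => <-.
      apply: eq_integral => x _; rewrite /F /= !normrM.
      rewrite /ind /=; case: ifP => _; rewrite ?normr1 ?normr0; last by rewrite !mulr0.
      by congr (_ * _ * _)%:E; rewrite /hh !patchE; case: ifP => // _;
        exact: normr0.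
    move=> /negP; rewrite inE /D /= in_itv /= => /negP yab.
    by apply: integral0_eq => x _; rewrite /F /= gg0 // mulr0 mul0r normr0.
  rewrite -integral_mkcond.
  by have /integrableP[] := intgh'.
have FE : {in D, fubini_F mu F =1
    EFin \o (fun x => h x * \int[mu]_(y in `[a, x]) g y)}.
  by move=> x; rewrite inE /D /= in_itv /= => xab; exact: Fx.
have intFD : mu.-integrable D
    (EFin \o (fun x => h x * \int[mu]_(y in `[a, x]) g y)).
  apply: (@eq_integrable _ _ R mu D (measurable_itv _) _ _ FE).
  apply: integrableS (integrable_fubini_F intF) => //.
  exact: measurable_itv.
split; first exact/integrable_itv_bndo_bndc.
have GE : {in D, fubini_G mu F =1
    EFin \o (fun y => g y * \int[mu]_(x in `[y, b]) h x)}.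
  move=> y; rewrite inE /D /= in_itv /= => yab.
  by rewrite /fubini_G /F /hh /= (Gy _ _ _ yab inth) ggE.
have mG : measurable_fun D (fun y => (g y * \int[mu]_(x in `[y, b]) h x)%:E).
  have mD : measurable_fun D (fubini_G mu F).
    by apply: measurable_funTS; exact: (measurable_fubini_G intF).
  by move: mD; apply: eq_measurable_fun => y /GE.
rewrite -Rintegral_itv_bndo_bndc // /Rintegral.
rewrite -[in RHS]integral_itv_bndo_bndc //; congr fine.
have FubE := @Fubini _ _ _ _ R mu mu F intF.
transitivity (\int[mu]_x (\int[mu]_y F (x, y)))%E.
  rewrite [LHS]integral_mkcond; apply: eq_integral => x _.
  rewrite patchE; case: ifPn => [xD|]; first exact: (esym (FE _ xD)).
  move=> /negP; rewrite inE /D /= in_itv /= => /negP xab.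
  by apply/esym/integral0_eq => y _; rewrite /F /= hh0 // !mul0r.
rewrite FubE [RHS]integral_mkcond; apply: eq_integral => y _.
rewrite patchE; case: ifPn => [yD|]; first exact: (GE _ yD).
move=> /negP; rewrite inE /D /= in_itv /= => /negP yab.
by apply: integral0_eq => x _; rewrite /F /= gg0 // mulr0 mul0r.
Qed.
End Triangle.

(** * The operator on real-valued functions *)

Section Operator.
Context {R : realType}.
Local Notation mu := (@lebesgue_measure R).
Variable lam : R.
Hypothesis lam0 : 0 <= lam.
Variable r : R -> R.
Local Notation w := (gweight (lam - 2^-1)).
Local Notation p := (gweight (lam + 2^-1)).
Local Notation q := (gweight (- lam - 2^-1)).
Hypothesis cr : {within `[-1, 1[, continuous r}.
Hypothesis ir : mu.-integrable `[-1, 1] (EFin \o (fun x => w x * r x)).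

(** [potential] is the real-valued version of the operator [Top], [flux] is the
    opposite of its derivative and [mass] is the inner integral. *)
Definition mass (y : R) : R := \int[mu]_(z in `[-1, y]) (w z * r z).
Definition flux (y : R) : R := q y * mass y.
Definition potential (x : R) : R := - \int[mu]_(y in `[-1, x]) flux y.

Let a0 : 0 < lam + 2^-1. Proof. by move: lam0; lra. Qed.
Let a2 : 2^-1 <= lam + 2^-1. Proof. by move: lam0; lra. Qed.
Let aE : lam - 2^-1 = lam + 2^-1 - 1. Proof. by field. Qed.
Let qE : q =1 (fun y => (p y)^-1).
Proof. by move=> y; rewrite -gweightV; congr gweight; ring. Qed.
Let iw : mu.-integrable `[-1, 1] (EFin \o (w : R -> R)).
Proof. by rewrite aE; exact: integrable_gweight. Qed.
Let N11 : -1 <= 1 :> R. Proof. by lra. Qed.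

Let ir_abs : mu.-integrable `[-1, 1] (EFin \o (fun x => `|w x * r x|)).
Proof. exact: (integrable_norm ir). Qed.

Lemma mass_continuous : {within `[-1, 1], continuous mass}.
Proof. exact: (parameterized_integral_continuous N11 ir). Qed.

Lemma measurable_flux : measurable_fun `[(-1 : R), 1] flux.
Proof.
apply: measurable_funM; first exact: measurable_gweight.
by apply: subspace_continuous_measurable_fun => //; exact: mass_continuous.
Qed.

Lemma normr_mass_le y : -1 <= y <= 1 ->
  `|mass y| <= \int[mu]_(z in `[-1, y]) `|w z * r z|.
Proof.
move=> /andP[y1 y2]; apply: le_normr_Rintegral => //.
exact: integrable_sub_itv (lexx _) y2 ir.
Qed.

Lemma mass_bounded : exists2 M, 0 <= M & forall y, -1 <= y <= 1 -> `|mass y| <= M.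
Proof.
have /compact_bounded[M [_ mrt]] :=
  continuous_compact mass_continuous (@segment_compact _ (-1) 1).
exists (`|M| + 1) => [|y y1]; first by rewrite addr_ge0.
apply: mrt; first by rewrite ltr_pwDr // ler_norm.
by exists y => //=; rewrite in_itv.
Qed.

(** Near [-1] the function [r] is bounded, so the mass is at most a multiple of
    the integral of the weight, which compensates the outer weight. *)
Lemma flux_bounded_left :
  exists2 C, 0 <= C & forall y, -1 <= y -> y <= - 2^-1 -> `|flux y| <= C.
Proof.
have sub : `[(-1 : R), - 2^-1] `<=` `[(-1 : R), 1[.
  by apply: subset_itvl; rewrite bnd_simp; lra.
have /compact_bounded[M [_ mrt]] := continuous_compact
  (continuous_subspaceW sub cr) (@segment_compact _ (-1) (- 2^-1)).
pose K := `|M| + 1.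
have rK z : -1 <= z -> z <= - 2^-1 -> `|r z| <= K.
  move=> z1 z2; apply: mrt; first by rewrite ltr_pwDr // ler_norm.
  by exists z => //=; rewrite in_itv /= z1.
have K0 : 0 <= K by rewrite addr_ge0.
exists (2 * K) => [|y y1 y2]; first by rewrite mulr_ge0.
have yle1 : y <= 1 by lra.
have [->|yN1] := eqVneq y (-1).
  by rewrite /flux /mass set_itv1 Rintegral_set1 mulr0 normr0 mulr_ge0.
have yin : -1 < y < 1 by rewrite lt_neqAle eq_sym yN1 y1 /=; lra.
have p0 : 0 < p y := gweight_gt0 _ yin.
rewrite /flux qE normrM gtr0_norm ?invr_gt0 // mulrC ler_pdivrMr //.
apply: le_trans (normr_mass_le _) _; first by rewrite y1.
apply: (@le_trans _ _ (\int[mu]_(z in `[-1, y]) (K * w z))).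
  apply: le_Rintegral => //.
  - exact: integrable_sub_itv (lexx _) yle1 ir_abs.
  - apply: (integrable_scale _ (measurable_itv _)).
    exact: integrable_sub_itv (lexx _) yle1 iw.
  - move=> z /=; rewrite in_itv /= => /andP[z1 z2].
    rewrite normrM (ger0_norm (gweight_ge0 _ _)) mulrC.
    by rewrite ler_wpM2r ?gweight_ge0 // rK // (le_trans z2).
rewrite RintegralZl //; last exact: integrable_sub_itv (lexx _) yle1 iw.
rewrite mulrAC [leRHS]mulrC ler_wpM2l // aE.
exact: integral_gweight_left_le.
Qed.

Lemma flux_bounded b : b < 1 ->
  exists2 C, 0 <= C & forall y, -1 <= y -> y <= b -> `|flux y| <= C.
Proof.
move=> b1; have [C1 C10 hC1] := flux_bounded_left.
have [M M0 hM] := mass_bounded.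
have cq : {within `[- 2^-1, b], continuous (q : R -> R)}.
  apply: continuous_in_subspaceT => x; rewrite inE /= in_itv /=.
  by move=> /andP[x1 x2]; apply: continuous_gweight_in; lra.
have /compact_bounded[C2 [_ mrt]] :=
  continuous_compact cq (@segment_compact _ (- 2^-1) b).
pose K := `|C2| + 1.
have K0 : 0 <= K by rewrite addr_ge0.
have qK z : - 2^-1 <= z -> z <= b -> `|q z| <= K.
  move=> z1 z2; apply: mrt; first by rewrite ltr_pwDr // ler_norm.
  by exists z => //=; rewrite in_itv /= z1.
exists (C1 + K * M) => [|y y1 yb]; first by rewrite addr_ge0 ?mulr_ge0.
have [y2|/ltW y2] := leP y (- 2^-1).
  by rewrite ler_wpDr ?mulr_ge0 // hC1.
rewrite ler_wpDl // /flux normrM ler_pM ?normr_ge0 ?qK // hM // y1 /=.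
exact: ltW (le_lt_trans yb b1).
Qed.

Lemma integrable_flux b : b < 1 -> mu.-integrable `[-1, b] (EFin \o flux).
Proof.
move=> b1; have [C C0 hC] := flux_bounded b1.
apply: (@dominated_integrable _ _ (fun=> C)) => //.
- apply: measurable_funS measurable_flux => //.
  by apply: subset_itvl; rewrite bnd_simp ltW.
- by move=> x /=; rewrite in_itv /= => /andP[x1 x2]; exact: hC.
- exact: integrable_cst.
Qed.


(** The weight [(1 - x^2)^(-lam - 1/2)] of the outer integral and the tail
    integral of the inner weight compensate each other at [1]. *)
Lemma gweight_tail_le y : 2^-1 <= y -> y <= 1 ->
  q y * \int[mu]_(x in `[y, 1]) w x <= 2.
Proof.
move=> y2 y1; have [->|yN1] := eqVneq y 1.
  by rewrite set_itv1 Rintegral_set1 mulr0.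
have yin : -1 < y < 1.
  by apply/andP; split; [lra|rewrite lt_neqAle yN1].
rewrite qE mulrC ler_pdivrMr ?gweight_gt0 // aE.
exact: integral_gweight_right_le.
Qed.

(** The tail integral compensates the outer weight near [1] and the mass does so
    near [-1], whence a bound on the whole interval. *)
Lemma integrable_flux_tail (V : {poly R}) :
  mu.-integrable `[-1, 1] (EFin \o (fun x => V.[x] * w x)) ->
  mu.-integrable `[-1, 1]
    (EFin \o (fun y => flux y * \int[mu]_(x in `[y, 1]) `|V.[x] * w x|)).
Proof.
move=> iVw; have ih := integrable_norm iVw.
pose h x := `|V.[x] * w x|.
pose H y := \int[mu]_(x in `[y, 1]) h x.
have cH : {within `[-1, 1], continuous H}.
  exact: continuous_tail_integral N11 ih.
have H0 y : 0 <= H y by apply: Rintegral_ge0 => x _; exact: normr_ge0.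
have half : 2^-1 < 1 :> R by lra.
have [C C0 hC] := flux_bounded half.
have [M M0 hM] := mass_bounded.
have /compact_bounded[BH [_ BHP]] :=
  continuous_compact cH (@segment_compact _ (-1) 1).
have cV : {within `[-1, 1], continuous (horner V)}.
  by apply: continuous_subspaceT; exact: continuous_horner.
have /compact_bounded[B [_ BP]] :=
  continuous_compact cV (@segment_compact _ (-1) 1).
pose K := `|B| + 1; pose KH := `|BH| + 1.
have K0 : 0 <= K by rewrite addr_ge0.
have VK x : -1 <= x -> x <= 1 -> `|V.[x]| <= K.
  move=> x1 x2; apply: BP; first by rewrite ltr_pwDr // ler_norm.
  by exists x => //=; rewrite in_itv /= x1.
have HK x : -1 <= x -> x <= 1 -> `|H x| <= KH.
  move=> x1 x2; apply: BHP; first by rewrite ltr_pwDr // ler_norm.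
  by exists x => //=; rewrite in_itv /= x1.
apply: (@dominated_integrable _ _ (fun=> C * KH + M * (K * 2))) => //; last first.
- exact: integrable_cst.
- move=> y /=; rewrite in_itv /= => /andP[y1 y2]; rewrite -/(h _) -/(H y) normrM.
  have [y3|/ltW y3] := leP y 2^-1.
    by rewrite ler_wpDr ?mulr_ge0 // ler_pM ?normr_ge0 // ?HK // hC.
  rewrite ler_wpDl ?mulr_ge0 ?addr_ge0 //.
  rewrite (ger0_norm (H0 y)) /flux normrM (ger0_norm (gweight_ge0 _ _)).
  rewrite mulrAC mulrC ler_pM ?mulr_ge0 ?gweight_ge0 ?normr_ge0 ?hM ?y1 //.
  apply: (@le_trans _ _ (q y * (K * \int[mu]_(x in `[y, 1]) w x))).
    rewrite ler_wpM2l ?gweight_ge0 // -RintegralZl //; last first.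
      exact: integrable_sub_itv y1 (lexx _) iw.
    apply: le_Rintegral => //.
    - exact: integrable_sub_itv y1 (lexx _) ih.
    - apply: (integrable_scale _ (measurable_itv _)).
      exact: integrable_sub_itv y1 (lexx _) iw.
    - move=> x /=; rewrite in_itv /= => /andP[x1 x2].
      rewrite /h normrM (ger0_norm (gweight_ge0 _ _)) ler_wpM2r ?gweight_ge0 //.
      by rewrite VK // (le_trans y1).
  by rewrite mulrCA ler_wpM2l // gweight_tail_le.
- apply: measurable_funM; first exact: measurable_flux.
  by apply: subspace_continuous_measurable_fun.
Qed.

Lemma integrable_poly_weight (V : {poly R}) :
  mu.-integrable `[-1, 1] (EFin \o (fun x => V.[x] * w x)).
Proof. by rewrite aE; exact: integrable_poly_gweight. Qed.

Lemma potential_fubini (V : {poly R}) :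
  mu.-integrable `[-1, 1] (EFin \o (fun x => V.[x] * w x * potential x)) /\
  \int[mu]_(x in `[-1, 1]) (V.[x] * w x * potential x) =
  - \int[mu]_(y in `[-1, 1]) (flux y * \int[mu]_(x in `[y, 1]) (V.[x] * w x)).
Proof.
have iV := integrable_poly_weight V.
have iflux x : -1 <= x < 1 -> mu.-integrable `[-1, x] (EFin \o flux).
  by move=> /andP[_]; exact: integrable_flux.
have [i1 E] :=
  triangle_fubini measurable_flux iV iflux (integrable_flux_tail iV).
have eV x : V.[x] * w x * potential x =
    -1 * (V.[x] * w x * \int[mu]_(y in `[-1, x]) flux y).
  by rewrite /potential; ring.
split.
  rewrite (_ : (fun x => _) = (fun x => -1 * (V.[x] * w x *
    \int[mu]_(y in `[-1, x]) flux y))); last by apply/funext => x; exact: eV.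
  exact: (integrable_scale _ (measurable_itv _) i1).
by under eq_Rintegral do rewrite eV; rewrite RintegralZl // E mulN1r.
Qed.

(** The effect of the operator on coefficients. Two exchanges of integrals play
    the part of two integrations by parts; the first one produces the tail
    integral of [W w], which by the differential equation is [W'] times the
    inverse of the outer weight, and the second one produces the tail integral
    [1 - W] of [W']. *)
Lemma potential_gegenbauer n :
  let W := gegenbauer_poly lam n in
  n%:R * (n%:R + 2 * lam) *
    \int[mu]_(x in `[-1, 1]) (W.[x] * w x * potential x) =
  \int[mu]_(x in `[-1, 1]) (W.[x] * (w x * r x)) -
    \int[mu]_(x in `[-1, 1]) (w x * r x).
Proof.
move=> W; pose c := n%:R * (n%:R + 2 * lam).
have [iW _] := potential_fubini W.
have [_ E] := potential_fubini (c *: W).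
have -> : c * \int[mu]_(x in `[-1, 1]) (W.[x] * w x * potential x) =
    \int[mu]_(x in `[-1, 1]) ((c *: W).[x] * w x * potential x).
  by rewrite -RintegralZl //; apply: eq_Rintegral => x _; rewrite hornerZ; ring.
rewrite {}E.
have tailE (y : R) : -1 <= y <= 1 ->
    \int[mu]_(x in `[y, 1]) ((c *: W).[x] * w x) = W^`().[y] * p y.
  move=> /andP[y1 y2].
  have := integral_gegenbauer n lam0 y1 y2 (lexx _).
  rewrite /= (gweight_boundary (lt0r_neq0 a0)).2 mulr0 subr0 -/W => <-.
  rewrite -RintegralZl //; last first.
    exact: integrable_sub_itv y1 (lexx _) (integrable_poly_weight W).
  by apply: eq_Rintegral => x _; rewrite hornerZ /c; ring.
have cW' : {within `[-1, 1], continuous (horner W^`())}.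
  by apply: continuous_subspaceT; exact: continuous_horner.
have iW' : mu.-integrable `[-1, 1] (EFin \o horner W^`()).
  by apply: continuous_compact_integrable => //; exact: segment_compact.
have -> : \int[mu]_(y in `[-1, 1])
      (flux y * \int[mu]_(x in `[y, 1]) ((c *: W).[x] * w x)) =
    \int[mu]_(y in `[-1, 1]) (W^`().[y] * mass y).
  transitivity (\int[mu]_(y in `[-1, 1]) (flux y * (W^`().[y] * p y))).
    by apply: eq_Rintegral => y; rewrite inE /= in_itv /= => /tailE ->.
  have mW' (g : R -> R) : measurable_fun `[(-1 : R), 1] g ->
      measurable_fun `](-1 : R), 1[ (fun y => W^`().[y] * g y).
    move=> mg; apply: measurable_funM; first exact: measurable_horner.
    by apply: measurable_funS mg => //; exact: subset_itv_oo_cc.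
  have mm : measurable_fun `[(-1 : R), 1] mass.
    by apply: subspace_continuous_measurable_fun => //; exact: mass_continuous.
  rewrite /Rintegral; congr fine; apply: eq_integral_itv_bounded.
  - rewrite (_ : (fun y => _) = (fun y => W^`().[y] * (flux y * p y))); last first.
      by apply/funext => y; ring.
    apply: mW'; apply: measurable_funM; first exact: measurable_flux.
    exact: measurable_gweight.
  - exact: mW'.
  move=> y; rewrite in_itv /= => y1.
  have p0 : p y != 0 by rewrite gt_eqF // gweight_gt0.
  rewrite /flux (_ : - lam - 2^-1 = - (lam + 2^-1)); last by ring.
  by rewrite gweightV; field.
have mwr : measurable_fun `[(-1 : R), 1] (fun x => w x * r x).
  by move/integrableP : ir => [/measurable_EFinP].
have iwr (x : R) : -1 <= x < 1 -> mu.-integrable `[-1, x] (EFin \o (fun x => w x * r x)).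
  by move=> /andP[x1 /ltW x2]; exact: integrable_sub_itv (lexx _) x2 ir.
have itail : mu.-integrable `[-1, 1]
    (EFin \o (fun y => w y * r y * \int[mu]_(x in `[y, 1]) `|W^`().[x]|)).
  have cT := continuous_tail_integral N11 (integrable_norm iW').
  rewrite (_ : (fun y => _) = (fun y =>
    \int[mu]_(x in `[y, 1]) `|W^`().[x]| * (w y * r y))); last first.
    by apply/funext => y; rewrite mulrC.
  exact: integrable_mul_continuous cT ir.
have [_ ->] := triangle_fubini mwr iW' iwr itail.
have FTC (y : R) : -1 <= y <= 1 -> \int[mu]_(x in `[y, 1]) W^`().[x] = 1 - W.[y].
  move=> /andP[y1 y2].
  have -> : 1 - W.[y] = W.[1] - W.[y] by rewrite gegenbauer_at1.
  apply: (improper_FTC2 (F := horner W)) => //.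
  - by apply: continuous_subspaceT; exact: continuous_horner.
  - by move=> x _; exact: continuous_horner.
  - exact: integrable_sub_itv y1 (lexx _) iW'.
have cW : {within `[-1, 1], continuous (horner W)}.
  by apply: continuous_subspaceT; exact: continuous_horner.
have iWr := integrable_mul_continuous cW ir.
transitivity (- \int[mu]_(y in `[-1, 1]) (w y * r y - W.[y] * (w y * r y))).
  by congr (- _); apply: eq_Rintegral => y;
    rewrite inE /= in_itv /= => /FTC ->; ring.
by rewrite RintegralB // opprB.
Qed.

Lemma mass_tail y : mass 1 = 0 -> -1 <= y <= 1 ->
  mass y = - \int[mu]_(x in `[y, 1[) (w x * r x).
Proof.
move=> m0 /andP[y1 y2].
have iry := integrable_sub_itv y1 (lexx _) ir.
rewrite Rintegral_itv_bndo_bndc; last exact/integrable_itv_bndo_bndc.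
have := @Rintegral_itvB R _ (BLeft (-1)) (BRight 1) y ir.
rewrite !bnd_simp => /(_ y1 y2); rewrite -/(mass 1) -/(mass y) m0 sub0r => h.
rewrite -[LHS]opprK h Rintegral_itv_obnd_cbnd //.
by apply: integrableS iry => //; apply: subset_itvr; rewrite bnd_simp.
Qed.

Lemma integral_weight_bound_tail K c y : 0 <= K -> 2^-1 <= c -> c <= y < 1 ->
  K * (q y * \int[mu]_(x in `[y, 1[) w x) <= 2 * K.
Proof.
move=> K0 c2 /andP[cy y1]; rewrite mulrC ler_wpM2r //.
have y2 : 2^-1 <= y := le_trans c2 cy.
have yN1 : -1 <= y by lra.
have iwy : mu.-integrable `[y, 1] (EFin \o (w : R -> R)).
  apply: integrable_sub_itv yN1 (lexx _) _.
  by rewrite (_ : lam - 2^-1 = lam + 2^-1 - 1); [exact: integrable_gweight|field].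
rewrite Rintegral_itv_bndo_bndc; last exact/integrable_itv_bndo_bndc.
exact: gweight_tail_le y2 (ltW y1).
Qed.

(** As the total mass vanishes, the mass on [[-1, y]] is opposite to the mass on
    [[y, 1]], so that a lower bound on [r] near [1] is an upper bound on the
    flux, the tail integral of the weight compensating the outer weight. *)
Lemma flux_le K c : mass 1 = 0 -> 0 <= K -> 2^-1 <= c ->
  (forall x, c <= x < 1 -> - K <= r x) ->
  forall y, c <= y < 1 -> flux y <= 2 * K.
Proof.
move=> m0 K0 c2 rK y cy1; have /andP[cy y1] := cy1.
apply: le_trans (integral_weight_bound_tail K0 c2 cy1).
have yN1 : -1 <= y by lra.
have iwy : mu.-integrable `[y, 1[ (EFin \o (w : R -> R)).
  apply/integrable_itv_bndo_bndc; apply: integrable_sub_itv yN1 (lexx _) _.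
  by rewrite (_ : lam - 2^-1 = lam + 2^-1 - 1); [exact: integrable_gweight|field].
have iry : mu.-integrable `[y, 1[ (EFin \o (fun x => w x * r x)).
  by apply/integrable_itv_bndo_bndc; exact: integrable_sub_itv yN1 (lexx _) ir.
rewrite /flux mulrCA ler_wpM2l ?gweight_ge0 //.
rewrite mass_tail //; last by rewrite yN1 ltW.
rewrite lerNl -mulNr -RintegralZl //; apply: le_Rintegral => //.
  exact: (integrable_scale _ (measurable_itv _) iwy).
move=> x /=; rewrite in_itv /= => /andP[yx x1].
by rewrite mulrC ler_wpM2l ?gweight_ge0 // rK // (le_trans cy).
Qed.

Lemma flux_ge K c : mass 1 = 0 -> 0 <= K -> 2^-1 <= c ->
  (forall x, c <= x < 1 -> r x <= K) ->
  forall y, c <= y < 1 -> - (2 * K) <= flux y.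
Proof.
move=> m0 K0 c2 rK y cy1; have /andP[cy y1] := cy1; rewrite lerNl.
apply: le_trans (integral_weight_bound_tail K0 c2 cy1).
have yN1 : -1 <= y by lra.
have iwy : mu.-integrable `[y, 1[ (EFin \o (w : R -> R)).
  apply/integrable_itv_bndo_bndc; apply: integrable_sub_itv yN1 (lexx _) _.
  by rewrite (_ : lam - 2^-1 = lam + 2^-1 - 1); [exact: integrable_gweight|field].
have iry : mu.-integrable `[y, 1[ (EFin \o (fun x => w x * r x)).
  by apply/integrable_itv_bndo_bndc; exact: integrable_sub_itv yN1 (lexx _) ir.
rewrite /flux -mulrN mulrCA ler_wpM2l ?gweight_ge0 //.
rewrite mass_tail //; last by rewrite yN1 ltW.
rewrite opprK -RintegralZl //; apply: le_Rintegral => //.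
  exact: (integrable_scale _ (measurable_itv _) iwy).
move=> x /=; rewrite in_itv /= => /andP[yx x1].
by rewrite mulrC ler_wpM2r ?gweight_ge0 // rK // (le_trans cy).
Qed.

Lemma potential_continuous : {within `[-1, 1[, continuous potential}.
Proof.
apply: within_continuous_itvco => b b1 b2.
have cI := parameterized_integral_continuous b1 (integrable_flux b2).
by move=> x; apply: cvgN; exact: cI.
Qed.

End Operator.

(** * The operator and the inner product on extended real-valued functions *)

Section ExtendedReal.
Context {R : realType}.
Local Notation mu := (@lebesgue_measure R).
Implicit Types (lam x : R) (f g : R -> \bar R) (u v r : R -> R).

(** The value at [1] may be infinite, but a single point is negligible. *)
Lemma ginner_real lam f g u v :
  (forall x, -1 <= x < 1 -> f x = (u x)%:E) ->
  (forall x, -1 <= x < 1 -> g x = (v x)%:E) ->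
  mu.-integrable `[-1, 1]
    (EFin \o (fun x => u x * v x * gweight (lam - 2^-1) x)) ->
  ginner lam f g =
  (\int[mu]_(x in `[-1, 1]) (u x * v x * gweight (lam - 2^-1) x))%:E.
Proof.
move=> fu gv iuv; rewrite /Rintegral fineK; last exact: integrable_fin_num.
have E : {in `[(-1 : R), 1[%classic, (fun x => (u x * v x * gweight (lam - 2^-1) x)%:E)
    =1 (fun x => f x * g x * (gweight (lam - 2^-1) x)%:E)%E}.
  by move=> x; rewrite inE /= in_itv /= => x1; rewrite fu // gv.
have m1 : measurable_fun `[(-1 : R), 1[
    (fun x => (u x * v x * gweight (lam - 2^-1) x)%:E).
  by apply/emeasurable_fun_itv_bndo_bndcP; case/integrableP : iuv.
rewrite /ginner -integral_itv_bndo_bndc; last exact: eq_measurable_fun E m1.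
rewrite -[in RHS]integral_itv_bndo_bndc //.
by apply: eq_integral => x /E ->.
Qed.

Lemma integrable_extend f u : (forall x, -1 <= x < 1 -> f x = (u x)%:E) ->
  mu.-integrable `[-1, 1] (EFin \o u) <-> mu.-integrable `[-1, 1] f.
Proof.
move=> fu; split=> /integrable_itv_bndo_bndc h; apply/integrable_itv_bndo_bndc.
  apply: eq_integrable h => // x; rewrite inE /= in_itv /= => /fu ->.
  by [].
apply: eq_integrable h => // x; rewrite inE /= in_itv /= => /fu ->.
by [].
Qed.

Section TopReal.
Variables (lam : R) (f : R -> \bar R) (r : R -> R).
Hypothesis lam0 : 0 <= lam.
Hypothesis fr : forall x, -1 <= x < 1 -> f x = (r x)%:E.
Hypothesis cr : {within `[-1, 1[, continuous r}.
Local Notation w := (gweight (lam - 2^-1)).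
Hypothesis ir : mu.-integrable `[-1, 1] (EFin \o (fun x => w x * r x)).

Lemma Top_flux x : -1 <= x <= 1 ->
  (Top lam f x = - \int[mu]_(y in `[(-1)%R, x]) (flux lam r y)%:E)%E.
Proof.
move=> /andP[x1 x2]; congr (- _)%E; apply: eq_integral => y.
rewrite inE /= in_itv /= => /andP[y1 yx].
have [->|yN1] := eqVneq y 1.
  (* At the endpoint the outer weight is [0 `^ a] with [a < 0], which is [0]. *)
  rewrite /flux (gweight_boundary (_ : - lam - 2^-1 != 0)).2 ?mul0e ?mul0r //.
  by rewrite lt_eqF //; move: lam0; lra.
have ylt1 : y < 1 by rewrite lt_neqAle yN1 (le_trans yx).
rewrite /flux EFinM; congr (_ * _)%E.
rewrite /mass /Rintegral fineK; last first.
  apply: integrable_fin_num => //.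
  exact: integrable_sub_itv (lexx _) (ltW ylt1) ir.
apply: eq_integral => z; rewrite inE /= in_itv /= => /andP[z1 zy].
by rewrite fr // z1 (le_lt_trans zy).
Qed.

Lemma Top_potential x : -1 <= x < 1 -> Top lam f x = (potential lam r x)%:E.
Proof.
move=> /andP[x1 x2]; rewrite Top_flux; last by rewrite x1 ltW.
rewrite /potential EFinN; congr (- _)%E; rewrite /Rintegral fineK //.
by apply: integrable_fin_num => //; exact: integrable_flux.
Qed.

Lemma Top_cvg c K : -1 < c -> c < 1 ->
  (forall x, c <= x < 1 -> flux lam r x <= K) \/
  (forall x, c <= x < 1 -> - K <= flux lam r x) ->
  Top lam f x @[x --> (1 : R)^'-] --> Top lam f 1.
Proof.
move=> c1 c2 hK.
have N11 : -1 < 1 :> R by lra.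
rewrite Top_flux; last by rewrite lexx andbT ltW.
have h : (- \int[mu]_(y in `[(-1)%R, x]) (flux lam r y)%:E)%E @[x --> (1 : R)^'-]
    --> (- \int[mu]_(y in `[(-1)%R, 1%R]) (flux lam r y)%:E)%E.
  apply: cvgeN; apply: (integral_cvg_at_left (c := c) (M := K)) => //.
  - by rewrite c1.
  - exact: measurable_flux ir.
  - exact: integrable_flux.
apply: cvg_trans h; apply: near_eq_cvg; near=> x; apply/esym/Top_flux.
by apply/andP; split; near: x; [exact: nbhs_left_ge|exact: nbhs_left_le].
Unshelve. all: by end_near. Qed.

Lemma ginner_Top :
  ginner lam (e0 R) (Top lam f) =
  (\int[mu]_(x in `[-1, 1]) (w x * potential lam r x))%:E.
Proof.
have [iV _] := potential_fubini lam0 cr ir 1.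
have E : (fun x => (1 : {poly R}).[x] * w x * potential lam r x) =
    (fun x => 1 * potential lam r x * w x).
  by apply/funext => x; rewrite hornerC mulrAC.
rewrite (ginner_real (u := fun=> 1) (v := potential lam r)) //.
- by congr EFin; apply: eq_Rintegral => x _; ring.
- exact: Top_potential.
- by rewrite -E.
Qed.

Lemma ginner_gegenbauer n :
  ginner lam f (EFin \o gegenbauer lam n) =
  (\int[mu]_(x in `[-1, 1]) ((gegenbauer_poly lam n).[x] * (w x * r x)))%:E.
Proof.
have cW : {within `[-1, 1], continuous (horner (gegenbauer_poly lam n))}.
  by apply: continuous_subspaceT; exact: continuous_horner.
have iW := integrable_mul_continuous cW ir.
have E : (fun x => (gegenbauer_poly lam n).[x] * (w x * r x)) =
    (fun x => r x * gegenbauer lam n x * w x).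
  by apply/funext => x; rewrite horner_gegenbauer; ring.
rewrite (ginner_real (u := r) (v := gegenbauer lam n)) //.
- by rewrite E.
- by rewrite -E.
Qed.

End TopReal.

Lemma ginner_gegenbauer_sqr lam n : 0 <= lam ->
  ginner lam (EFin \o gegenbauer lam n) (EFin \o gegenbauer lam n) =
  (\int[mu]_(x in `[-1, 1])
    ((gegenbauer_poly lam n).[x] ^+ 2 * gweight (lam - 2^-1) x))%:E.
Proof.
move=> lam0; have i := integrable_poly_weight lam0 (gegenbauer_poly lam n ^+ 2).
have E : (fun x => (gegenbauer_poly lam n ^+ 2).[x] * gweight (lam - 2^-1) x) =
    (fun x => gegenbauer lam n x * gegenbauer lam n x * gweight (lam - 2^-1) x).
  by apply/funext => x; rewrite horner_exp horner_gegenbauer expr2.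
rewrite (ginner_real (u := gegenbauer lam n) (v := gegenbauer lam n)) -?E //.
by congr EFin; apply: eq_Rintegral => x _; rewrite horner_exp.
Qed.

Lemma ginner_e0 lam : 0 <= lam ->
  ginner lam (e0 R) (e0 R) = (\int[mu]_(x in `[-1, 1]) gweight (lam - 2^-1) x)%:E.
Proof.
move=> lam0; have i := integrable_poly_weight lam0 1.
have E : (fun x => (1 : {poly R}).[x] * gweight (lam - 2^-1) x) =
    (fun x => 1 * 1 * gweight (lam - 2^-1) x).
  by apply/funext => x; rewrite hornerC !mul1r.
rewrite (ginner_real (u := fun=> 1) (v := fun=> 1)) -?E //.
by congr EFin; apply: eq_Rintegral => x _; rewrite hornerC mul1r.
Qed.

End ExtendedReal.

(** * Completeness of Gegenbauer polynomials *)

Section Completeness.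
Context {R : realType}.
Local Notation mu := (@lebesgue_measure R).
Implicit Types (lam x : R) (f r : R -> R) (P : {poly R}).

Lemma bernoulli_le (e : R) n : 0 <= e -> 1 + n%:R * e <= (1 + e) ^+ n.
Proof.
move=> e0; elim: n => [|n IH]; first by rewrite mul0r addr0.
rewrite exprS -natr1; have n0 : 0 <= n%:R :> R by [].
apply: le_trans (_ : _ <= (1 + e) * (1 + n%:R * e)) _.
  by have := mulr_ge0 n0 (mulr_ge0 e0 e0); nra.
by rewrite ler_wpM2l // addr_ge0.
Qed.

Lemma integrable_poly_mul P f : mu.-integrable `[-1, 1] (EFin \o f) ->
  mu.-integrable `[-1, 1] (EFin \o (fun x => P.[x] * f x)).
Proof.
apply: integrable_mul_continuous.
by apply: continuous_subspaceT; exact: continuous_horner.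
Qed.

(** Powers of [1 + (delta^2 - (x - x0)^2) / 8] stay in [[0, 1]] on the part of
    [[-1, 1]] at distance at least [delta] from [x0], and grow without bound
    near [x0]. *)
Lemma peak_polynomial f x0 : mu.-integrable `[-1, 1] (EFin \o f) ->
  -1 < x0 < 1 -> {for x0, continuous f} -> 0 < f x0 ->
  exists P, 0 < \int[mu]_(x in `[-1, 1]) (P.[x] * f x).
Proof.
move=> intf /andP[x01 x02] cf f0; pose c := f x0 / 2.
have c0 : 0 < c by rewrite divr_gt0.
have [e e0 he] : exists2 e, 0 < e & forall x, `|x - x0| < e -> c <= f x.
  have /cvgrPdist_lt /(_ c c0) [e /= e0 he] := cf.
  exists e => // x xe; have := he x; rewrite /= distrC => /(_ xe).
  by rewrite ltr_norml => /andP[_]; rewrite /c; lra.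
have [dl [d0 de d1 d2]] :
    exists dl, [/\ 0 < dl, dl < e, dl < 1 - x0 & dl < x0 + 1].
  (* The half makes the inequalities strict. *)
  exists (Num.min e (Num.min (1 - x0) (x0 + 1)) / 2).
  have m0 : 0 < Num.min e (Num.min (1 - x0) (x0 + 1)).
    by rewrite !lt_min e0 /=; lra.
  have m1 : Num.min e (Num.min (1 - x0) (x0 + 1)) <= e by rewrite ge_min lexx.
  have m2 : Num.min e (Num.min (1 - x0) (x0 + 1)) <= 1 - x0.
    by rewrite !ge_min lexx orbT.
  have m3 : Num.min e (Num.min (1 - x0) (x0 + 1)) <= x0 + 1.
    by rewrite !ge_min lexx !orbT.
  by split; lra.
pose Q : {poly R} := 1 + (8^-1)%:P * ((dl ^+ 2)%:P - ('X - x0%:P) ^+ 2).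
have QE x : Q.[x] = 1 + 8^-1 * (dl ^+ 2 - (x - x0) ^+ 2).
  by rewrite /Q !hornerE.
(* As [(x - x0)^2 <= 4], the factor [1 / 8] keeps [Q] above [1 / 2]. *)
have Q0 x : -1 <= x <= 1 -> 0 <= Q.[x] by rewrite QE => /andP[? ?]; nra.
(* At distance at most [dl / 2] from [x0] the peak exceeds [1] by at least
   [(dl^2 - dl^2 / 4) / 8]. *)
have [ep ep_gt0 epE] : exists2 ep, 0 < ep & ep = 3 * dl ^+ 2 / 32.
  by exists (3 * dl ^+ 2 / 32) => //; rewrite divr_gt0 // mulr_gt0 // exprn_gt0.
have ep0 := ltW ep_gt0.
pose J := `[x0 - dl / 2, x0 + dl / 2]%classic : set R.
have QJ x : J x -> 1 + ep <= Q.[x].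
  rewrite /J /= in_itv /= QE epE => /andP[h1 h2].
  have h3 : 0 <= dl / 2 - (x - x0) by lra.
  have h4 : 0 <= dl / 2 + (x - x0) by lra.
  by have := mulr_ge0 h3 h4; nra.
pose I := \int[mu]_(x in `[-1, 1]) `|f x|.
have [n hn] : exists n : nat, I < c * (1 + n%:R * ep) * dl.
  have k0 : 0 < c * ep * dl by rewrite (mulr_gt0 (mulr_gt0 c0 ep_gt0) d0).
  exists (Num.bound (I / (c * ep * dl))).
  have : I / (c * ep * dl) < (Num.bound (I / (c * ep * dl)))%:R.
    apply: archi_boundP; apply: divr_ge0 (ltW k0).
    by apply: Rintegral_ge0 => x _; exact: normr_ge0.
  rewrite ltr_pdivrMr // => /lt_le_trans; apply.
  set m := _%:R; have : 0 <= c * dl by rewrite mulr_ge0 ?ltW.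
  by nra.
exists (Q ^+ n).
have intQ := integrable_poly_mul (Q ^+ n) intf.
have intn := integrable_norm intf.
have intS := integrable_add (measurable_itv _) intQ intn.
(* Adding [`|f x|] makes the integrand nonnegative, so that the integral can be
   bounded below by its part over [J]. *)
pose S x := (Q ^+ n).[x] * f x + `|f x|.
have S0 x : -1 <= x <= 1 -> 0 <= S x.
  move=> x1; rewrite /S horner_exp.
  have [xd|xd] := ltP `|x - x0| e.
    by rewrite addr_ge0 // mulr_ge0 ?exprn_ge0 ?Q0 // (le_trans (ltW c0)) ?he.
  have Q1 : Q.[x] <= 1.
    rewrite QE; have : dl ^+ 2 <= (x - x0) ^+ 2.
      rewrite -[leRHS]real_normK ?num_real // ler_sqr ?nnegrE ?(ltW d0) //.
      exact: ltW (lt_le_trans de xd).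
    by lra.
  have : `|Q.[x] ^+ n * f x| <= `|f x|.
    rewrite normrM ger0_norm ?exprn_ge0 ?Q0 // ler_piMl //.
    by rewrite exprn_ile1 ?Q0.
  by rewrite ler_norml => /andP[]; lra.
have JD : J `<=` `[-1, 1].
  by apply: subset_itvScc; rewrite bnd_simp; lra.
have SJ x : J x -> c * (1 + n%:R * ep) <= S x.
  move=> xJ; rewrite /S horner_exp ler_wpDr // mulrC.
  apply: ler_pM; rewrite ?(ltW c0) ?addr_ge0 ?mulr_ge0 //.
    apply: le_trans (bernoulli_le n ep0) _.
    by rewrite lerXn2r ?nnegrE ?QJ ?addr_ge0 // (le_trans _ (QJ _ xJ)) ?addr_ge0.
  move: xJ; rewrite /J /= in_itv /= => /andP[? ?]; apply: he.
  by rewrite ltr_norml; apply/andP; split; lra.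
have intSJ : mu.-integrable J (EFin \o S).
  by apply: integrableS intS => //; exact: measurable_itv.
have h1 : c * (1 + n%:R * ep) * dl <= \int[mu]_(x in J) S x.
  have -> : c * (1 + n%:R * ep) * dl = \int[mu]_(x in J) (c * (1 + n%:R * ep)).
    rewrite Rintegral_cst; last exact: measurable_itv.
    rewrite /= lebesgue_measure_itv /= lte_fin ifT; last by lra.
    by rewrite -EFinB /=; field.
  apply: le_Rintegral => //; first exact: measurable_itv.
  exact: integrable_cst.
have h2 : \int[mu]_(x in J) S x <= \int[mu]_(x in `[-1, 1]) S x.
  rewrite -lee_fin /Rintegral !fineK; last 2 first.
  - by apply: integrable_fin_num.
  - by apply: integrable_fin_num => //; exact: measurable_itv.
  apply: ge0_subset_integral => //; first exact: measurable_itv.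
    by case/integrableP : intS.
have h3 : \int[mu]_(x in `[-1, 1]) S x =
    \int[mu]_(x in `[-1, 1]) ((Q ^+ n).[x] * f x) + I by rewrite RintegralD.
by rewrite -(ltrD2r I) add0r -h3; exact: lt_le_trans hn (le_trans h1 h2).
Qed.

Lemma gegenbauer_complete lam r : 0 <= lam ->
  {within `[-1, 1[, continuous r} ->
  mu.-integrable `[-1, 1] (EFin \o (fun x => gweight (lam - 2^-1) x * r x)) ->
  (forall n, \int[mu]_(x in `[-1, 1])
     ((gegenbauer_poly lam n).[x] * (gweight (lam - 2^-1) x * r x)) = 0) ->
  forall x, -1 <= x < 1 -> r x = 0.
Proof.
move=> lam0 cr ir ort.
pose f x := gweight (lam - 2^-1) x * r x.
have ortP P : \int[mu]_(x in `[-1, 1]) (P.[x] * f x) = 0.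
  apply: (@gegenbauer_span _ lam
    (fun P => \int[mu]_(x in `[-1, 1]) (P.[x] * f x)) lam0) => //.
  - move=> P1 P2; rewrite -RintegralD //; try exact: integrable_poly_mul.
    by apply: eq_Rintegral => x _; rewrite hornerD mulrDl.
  - move=> k P1; rewrite -RintegralZl //; last exact: integrable_poly_mul.
    by apply: eq_Rintegral => x _; rewrite hornerZ -mulrA.
have cin x : -1 < x < 1 -> {for x, continuous r}.
  move=> x1; have sub : `](-1 : R), 1[ `<=` `[(-1 : R), 1[.
    by apply: subset_itv; rewrite bnd_simp.
  have := continuous_subspaceW sub cr.
  rewrite continuous_open_subspace //.
  by apply; rewrite inE /= in_itv.
have rin x : -1 < x < 1 -> r x = 0.
  move=> x1; have w0 := gweight_gt0 (lam - 2^-1) x1.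
  have cf : {for x, continuous f}.
    by apply: cvgM; [exact: continuous_gweight_in|exact: cin].
  have [r0|r0|//] := ltgtP (r x) 0.
  - have intNf := integrable_scale (-1) (measurable_itv _) ir.
    have cNf : {for x, continuous (fun y => -1 * f y)}.
      by apply: cvgM; [exact: cvg_cst|exact: cf].
    have [|P] := peak_polynomial intNf x1 cNf.
      by rewrite mulN1r oppr_gt0 /f pmulr_rlt0.
    have -> : \int[mu]_(y in `[-1, 1]) (P.[y] * (-1 * f y)) =
        \int[mu]_(y in `[-1, 1]) ((- P).[y] * f y).
      by apply: eq_Rintegral => y _; rewrite hornerN; ring.
    by rewrite ortP ltxx.
  - have [|P] := peak_polynomial ir x1 cf; first by rewrite mulr_gt0.
    by rewrite ortP ltxx.
move=> x /andP[]; rewrite le_eqVlt => /predU1P[<- _|x1 x2]; last first.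
  by apply: rin; rewrite x1.
have N10 : -1 < 0 :> R by lra.
have sub : `[(-1 : R), 0] `<=` `[(-1 : R), 1[.
  by apply: subset_itvl; rewrite bnd_simp; lra.
have /(continuous_within_itvP _ N10)[_ rl _] := continuous_subspaceW sub cr.
have r0 : r y @[y --> (-1)^'+] --> (0 : R).
  apply: cvg_near_cst; near=> y.
  rewrite rin //; apply/andP; split; near: y; first exact: nbhs_right_gt.
  by apply: nbhs_right_lt; lra.
exact: (cvg_unique _ rl r0).
Unshelve. all: by end_near. Qed.

End Completeness.

(** * Thinplate splines *)

Section Spline.
Context {R : realType}.
Local Notation mu := (@lebesgue_measure R).
Variable d : nat.
Hypothesis hd : (2 <= d)%N.
Local Notation lam := (lambda_of R d).
Local Notation w := (gweight (lam - 2^-1)).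
Local Notation W := (gegenbauer_poly lam).
Implicit Types (k f : R -> \bar R) (r u : R -> R) (n m : nat) (x : R).

Let eigen n : R := n%:R * (n%:R + 2 * lam).
Let total : R := \int[mu]_(x in `[-1, 1]) w x.

Lemma lambda_of_ge0 : 0 <= lam.
Proof.
by rewrite /lambda_of divr_ge0 // subr_ge0 (ler_nat _ 2).
Qed.

Let lam0 := lambda_of_ge0.

Let eigen_gt0 n : (1 <= n)%N -> 0 < eigen n.
Proof.
move=> n1; have n0 : 0 < n%:R :> R by rewrite ltr0n.
by rewrite mulr_gt0 // ltr_wpDr // mulr_ge0.
Qed.

Let eigenE n : n%:R * (n%:R + d%:R - 2) = eigen n.
Proof. by rewrite /eigen /lambda_of; field. Qed.

Let total_gt0 : 0 < total.
Proof.
rewrite /total (_ : lam - 2^-1 = lam + 2^-1 - 1); last by field.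
by apply: integral_gweight_gt0; move: lam0; lra.
Qed.

Let normE n : dim_harmonics R d n *
  \int[mu]_(x in `[-1, 1]) ((W n).[x] ^+ 2 * w x) = total.
Proof. exact: (@gegenbauer_norm R d n hd). Qed.

Let norm_neq0 n :
  \int[mu]_(x in `[-1, 1]) ((W n).[x] ^+ 2 * w x) != 0.
Proof.
apply/eqP => h; have := normE n.
by rewrite h mulr0 => /eqP; rewrite lt_eqF // total_gt0.
Qed.

(** The definition of the spline of order [m], restated through a real-valued
    function that represents it on [[-1, 1[]; by the norm formula the
    normalized coefficients amount to [eigen n ^+ m] times the [n]-th
    unnormalized coefficient being the total mass of the weight. *)
Lemma thinplate_spline_intro m k u :
  (forall x, -1 <= x < 1 -> k x = (u x)%:E) ->
  {within `[-1, 1[, continuous u} ->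
  k x @[x --> (1 : R)^'-] --> k 1 ->
  mu.-integrable `[-1, 1] (EFin \o (fun x => w x * u x)) ->
  \int[mu]_(x in `[-1, 1]) (w x * u x) = 0 ->
  (forall n, (1 <= n)%N ->
    eigen n ^+ m * \int[mu]_(x in `[-1, 1]) ((W n).[x] * (w x * u x)) = total) ->
  is_thinplate_spline d m k.
Proof.
move=> ku cu k1 iu u0 un; split=> //.
- by move=> x /ku ->.
- apply: (subspace_eq_continuous _ cu) => x; rewrite inE /= in_itv /= => x1.
  by rewrite /from_subspace /= ku.
- apply/(integrable_extend (u := fun x => w x * u x)) => // x x1.
  by rewrite ku // -EFinM mulrC.
- rewrite (ginner_gegenbauer ku iu) gegenbauer0; congr EFin.
  by rewrite -[RHS]u0; apply: eq_Rintegral => x _; rewrite hornerC mul1r.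
move=> n n1 /=; rewrite (ginner_gegenbauer ku iu) ginner_gegenbauer_sqr //.
rewrite inver (negPf (norm_neq0 n)) -EFinM; congr EFin.
apply: (canLR (mulfK (norm_neq0 n))); rewrite -mulrA.
rewrite normE eigenE -(un n n1).
by rewrite mulrA mulVf ?mul1r // expf_neq0 // gt_eqF // eigen_gt0.
Qed.

Lemma thinplate_spline_elim m k : is_thinplate_spline d m k ->
  exists2 u, (forall x, -1 <= x < 1 -> k x = (u x)%:E) &
  [/\ {within `[-1, 1[, continuous u},
  mu.-integrable `[-1, 1] (EFin \o (fun x => w x * u x)),
  \int[mu]_(x in `[-1, 1]) (w x * u x) = 0 &
  forall n, (1 <= n)%N ->
    eigen n ^+ m * \int[mu]_(x in `[-1, 1]) ((W n).[x] * (w x * u x)) = total].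
Proof.
move=> [kfin kc _ ki k0 kn]; exists (fine \o k) => [x x1|].
  by rewrite /= fineK // kfin.
have ku x : -1 <= x < 1 -> k x = ((fine \o k) x)%:E.
  by move=> x1; rewrite /= fineK // kfin.
have iu : mu.-integrable `[-1, 1] (EFin \o (fun x => w x * (fine \o k) x)).
  apply/(integrable_extend (f := fun x => (k x * (w x)%:E)%E)) => // x x1.
  by rewrite [in LHS]ku // -EFinM mulrC.
split => //.
- move: k0; rewrite (ginner_gegenbauer ku iu) gegenbauer0 => -[h].
  by rewrite -[RHS]h; apply: eq_Rintegral => x _; rewrite hornerC mul1r.
move=> n n1; have := kn n n1.
rewrite /= (ginner_gegenbauer ku iu) ginner_gegenbauer_sqr //.
rewrite inver (negPf (norm_neq0 n)) -EFinM => -[].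
move=> /(canRL (divfK (norm_neq0 n))) ->.
rewrite -mulrA normE eigenE.
by rewrite mulrA mulfV ?mul1r // expf_neq0 // gt_eqF // eigen_gt0.
Qed.

Lemma thinplate_spline_eq m k k' :
  (forall x, -1 <= x <= 1 -> k x = k' x) ->
  is_thinplate_spline d m k' -> is_thinplate_spline d m k.
Proof.
move=> kk' sk'; have [u k'u [cu iu u0 un]] := thinplate_spline_elim sk'.
apply: thinplate_spline_intro cu _ iu u0 un.
  by move=> x x1; rewrite kk' ?k'u //; case/andP: x1 => -> /ltW ->.
rewrite kk' ?lexx ?andbT; last by lra.
apply: cvg_trans (tps_at1 sk'); apply: near_eq_cvg; near=> x.
apply/esym/kk'; apply/andP; split; near: x; last exact: nbhs_left_le.
by apply: nbhs_left_ge; lra.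
Unshelve. all: by end_near. Qed.

(** The difference of the two functions has vanishing coefficients, hence
    vanishes on [[-1, 1[]; the values at [1] are the limits. *)
Lemma thinplate_spline_unique m k k' :
  is_thinplate_spline d m k -> is_thinplate_spline d m k' ->
  forall x, -1 <= x <= 1 -> k x = k' x.
Proof.
move=> sk sk'.
have [u ku [cu iu u0 un]] := thinplate_spline_elim sk.
have [u' ku' [cu' iu' u0' un']] := thinplate_spline_elim sk'.
have vE x : w x * (u x - u' x) = w x * u x - w x * u' x by rewrite mulrBr.
have cW n : {within `[-1, 1], continuous (horner (W n))}.
  by apply: continuous_subspaceT; exact: continuous_horner.
have eqo x : -1 <= x < 1 -> k x = k' x.
  move=> x1; rewrite ku // ku' //; congr EFin; apply/eqP; rewrite -subr_eq0.
  apply/eqP; move: x x1; apply: (gegenbauer_complete lam0).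
  - by move=> x; apply: cvgB; [exact: cu|exact: cu'].
  - have iB := @integrableB _ _ R mu _ (measurable_itv _) _ _ iu iu'.
    by apply: eq_integrable iB => // x _ /=; rewrite mulrBr.
  move=> n; transitivity (\int[mu]_(x in `[-1, 1]) ((W n).[x] * (w x * u x)) -
      \int[mu]_(x in `[-1, 1]) ((W n).[x] * (w x * u' x))).
    rewrite -RintegralB //; [|exact: integrable_mul_continuous..].
    by apply: eq_Rintegral => x _; rewrite vE mulrBr.
  case: n => [|n].
    rewrite -[RHS](subrr (0 : R)) -{1}u0 -u0' gegenbauer0.
    by congr (_ - _); apply: eq_Rintegral => x _; rewrite hornerC mul1r.
  have en : eigen n.+1 ^+ m != 0 by rewrite expf_neq0 // gt_eqF // eigen_gt0.
  by apply: (mulfI en); rewrite mulrBr un // un' // subrr mulr0.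
move=> x /andP[x1]; rewrite le_eqVlt => /predU1P[->|x2]; last by apply: eqo; rewrite x1.
have h := tps_at1 sk; have h' := tps_at1 sk'.
have h2 : k x @[x --> (1 : R)^'-] --> k' 1.
  apply: cvg_trans h'; apply: near_eq_cvg; near=> y; apply/esym/eqo.
  apply/andP; split; near: y; last exact: nbhs_left_lt.
  by apply: nbhs_left_ge; lra.
exact: (cvg_unique _ h h2).
Unshelve. all: by end_near. Qed.

Lemma gegenbauer_mean0 n : (1 <= n)%N ->
  \int[mu]_(x in `[-1, 1]) ((W n).[x] * w x) = 0.
Proof.
move=> n1; have a0 : lam + 2^-1 != 0 by rewrite gt_eqF //; move: lam0; lra.
have N11 : -1 <= 1 :> R by lra.
have := integral_gegenbauer n lam0 (lexx _) N11 (lexx _).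
rewrite /= (gweight_boundary a0).1 (gweight_boundary a0).2 !mulr0 subrr.
move=> /eqP; rewrite mulf_eq0 -/(eigen n) gt_eqF ?eigen_gt0 //=.
by move=> /eqP.
Qed.

Let mean r : R :=
  (\int[mu]_(x in `[-1, 1]) (w x * potential lam r x)) / total.

(** Subtracting its mean from the potential of [r] kills the coefficient of
    degree [0] and leaves the others unchanged, these being the ones of [r]
    divided by the eigenvalues, up to the total mass of [r]. *)
Lemma centered_potential r :
  {within `[-1, 1[, continuous r} ->
  mu.-integrable `[-1, 1] (EFin \o (fun x => w x * r x)) ->
  let v x := potential lam r x - mean r in
  [/\ {within `[-1, 1[, continuous v},
  mu.-integrable `[-1, 1] (EFin \o (fun x => w x * v x)),
  \int[mu]_(x in `[-1, 1]) (w x * v x) = 0 &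
  forall n, (1 <= n)%N ->
    eigen n * \int[mu]_(x in `[-1, 1]) ((W n).[x] * (w x * v x)) =
    \int[mu]_(x in `[-1, 1]) ((W n).[x] * (w x * r x)) -
    \int[mu]_(x in `[-1, 1]) (w x * r x)].
Proof.
move=> cr ir v.
have cv : {within `[-1, 1[, continuous v}.
  have cpot := potential_continuous lam0 cr ir.
  by move=> x; apply: cvgB; [exact: cpot|exact: cvg_cst].
have iP (P : {poly R}) :
    mu.-integrable `[-1, 1] (EFin \o (fun x => P.[x] * w x * potential lam r x)).
  by have [] := potential_fubini lam0 cr ir P.
have iPw (P : {poly R}) : mu.-integrable `[-1, 1] (EFin \o (fun x => P.[x] * w x)).
  exact: integrable_poly_weight.
have split_v (P : {poly R}) :
    mu.-integrable `[-1, 1] (EFin \o (fun x => P.[x] * (w x * v x))) /\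
    \int[mu]_(x in `[-1, 1]) (P.[x] * (w x * v x)) =
    \int[mu]_(x in `[-1, 1]) (P.[x] * w x * potential lam r x) -
    mean r * \int[mu]_(x in `[-1, 1]) (P.[x] * w x).
  have i2 := integrable_scale (mean r) (measurable_itv _) (iPw P).
  have vE x : P.[x] * w x * potential lam r x - mean r * (P.[x] * w x) =
      P.[x] * (w x * v x) by rewrite /v; ring.
  split.
    have i3 := @integrableB _ _ R mu _ (measurable_itv _) _ _ (iP P) i2.
    by apply: eq_integrable i3 => // x _ /=; rewrite -vE.
  rewrite -RintegralZl // -RintegralB //.
  by apply: eq_Rintegral => x _; rewrite vE.
have one x (c : R) : (1 : {poly R}).[x] * c = c by rewrite hornerC mul1r.
split => //.
- by have [+ _] := split_v 1; apply: eq_integrable => // x _ /=; rewrite one.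
- have [_] := split_v 1.
  under eq_Rintegral do rewrite one.
  under [X in _ = X - _ -> _]eq_Rintegral do rewrite one.
  under [X in _ = _ - _ * X -> _]eq_Rintegral do rewrite one.
  by move=> ->; rewrite -/total /mean divfK ?subrr // gt_eqF // total_gt0.
move=> n n1; have [_ ->] := split_v (W n).
by rewrite gegenbauer_mean0 // mulr0 subr0; exact: potential_gegenbauer.
Qed.

Lemma mean_ginner f r :
  (forall x, -1 <= x < 1 -> f x = (r x)%:E) ->
  {within `[-1, 1[, continuous r} ->
  mu.-integrable `[-1, 1] (EFin \o (fun x => w x * r x)) ->
  (ginner lam (e0 R) (Top lam f) / ginner lam (e0 R) (e0 R))%E = (mean r)%:E.
Proof.
move=> fr cr ir; rewrite (ginner_Top lam0 fr cr ir) ginner_e0 //.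
by rewrite inver gt_eqF ?total_gt0.
Qed.

(** The constant function has total mass equal to that of the weight, and all its
    coefficients of positive degree vanish: its potential has the coefficients
    of the first spline up to sign. *)
Lemma thinplate_spline_base :
  is_thinplate_spline d 1 (fun x =>
    ginner lam (e0 R) (Top lam (e0 R)) / ginner lam (e0 R) (e0 R)
    - Top lam (e0 R) x)%E.
Proof.
pose r (_ : R) : R := 1.
have fr x : -1 <= x < 1 -> e0 R x = (r x)%:E by [].
have cr : {within `[-1, 1[, continuous r} by move=> x; exact: cvg_cst.
have ir : mu.-integrable `[-1, 1] (EFin \o (fun x => w x * r x)).
  have := integrable_poly_weight lam0 1.
  by apply: eq_integrable => // x _ /=; rewrite hornerC mulrC.
have [cv iv v0 vn] := centered_potential cr ir.
rewrite (mean_ginner fr cr ir).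
pose v x := potential lam r x - mean r.
apply: (@thinplate_spline_intro _ _ (fun x => - v x)).
- by move=> x x1; rewrite (Top_potential lam0 fr cr ir x1) -EFinB opprB.
- by move=> x; apply: cvgN; exact: cv.
- apply: cvgeB; [by rewrite fin_num_adde_defr|exact: cvg_cst|].
  apply: (Top_cvg lam0 fr cr ir (c := 0) (K := 0)); [lra|lra|right].
  move=> x _; rewrite oppr0 mulr_ge0 ?gweight_ge0 //.
  by apply: Rintegral_ge0 => z _; rewrite mulr1 gweight_ge0.
- have := integrable_scale (-1) (measurable_itv _) iv.
  by apply: eq_integrable => // x _ /=; rewrite mulN1r mulrN.
- transitivity (-1 * \int[mu]_(x in `[-1, 1]) (w x * v x)); last by rewrite v0 mulr0.
  by rewrite -RintegralZl //; apply: eq_Rintegral => x _; rewrite mulN1r mulrN.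
move=> n n1; rewrite expr1.
have cW : {within `[-1, 1], continuous (horner (W n))}.
  by apply: continuous_subspaceT; exact: continuous_horner.
have -> : \int[mu]_(x in `[-1, 1]) ((W n).[x] * (w x * - v x)) =
    -1 * \int[mu]_(x in `[-1, 1]) ((W n).[x] * (w x * v x)).
  rewrite -RintegralZl //; last exact: integrable_mul_continuous.
  by apply: eq_Rintegral => x _; ring.
rewrite mulN1r mulrN vn // opprB.
have -> : \int[mu]_(x in `[-1, 1]) (w x * r x) = total.
  by apply: eq_Rintegral => x _; rewrite mulr1.
have -> : \int[mu]_(x in `[-1, 1]) ((W n).[x] * (w x * r x)) = 0.
  by rewrite -(gegenbauer_mean0 n1); apply: eq_Rintegral => x _; rewrite mulr1.
by rewrite subr0.
Qed.

(** A spline has vanishing total mass, so the operator only divides its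
    coefficients by the eigenvalues. *)
Lemma thinplate_spline_step m k : is_thinplate_spline d m k ->
  is_thinplate_spline d m.+1 (fun x => Top lam k x
    - ginner lam (e0 R) (Top lam k) / ginner lam (e0 R) (e0 R))%E.
Proof.
move=> sk; have [r fr [cr ir r0 rn]] := thinplate_spline_elim sk.
have [cv iv v0 vn] := centered_potential cr ir.
rewrite (mean_ginner fr cr ir).
apply: thinplate_spline_intro cv _ iv v0 _.
- by move=> x x1; rewrite (Top_potential lam0 fr cr ir x1).
- apply: cvgeB; [by rewrite fin_num_adde_defl|..|exact: cvg_cst].
  have half : 2^-1 < 1 :> R by lra.
  have fr' x : 2^-1 <= x < 1 -> k x = (r x)%:E.
    by move=> /andP[x1 x2]; apply: fr; rewrite x2 andbT; lra.
  have [c [K [c1 c2 K0 hK]]] := cvg_at_left_one_sided half fr' (tps_at1 sk).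
  apply: (Top_cvg lam0 fr cr ir (c := c) (K := 2 * K)) => //; first by lra.
  by case: hK => hK; [left; exact: flux_le hK|right; exact: flux_ge hK].
move=> n n1; rewrite exprSr -mulrA vn // r0 subr0.
exact: rn.
Qed.

End Spline.

Theorem theorem5p1 (R : realType) (d : nat) (hd : (2 <= d)%N)
    (k : nat -> R -> \bar R) :
  let lam := lambda_of R d in
  (forall m : nat, (1 <= m)%N -> is_thinplate_spline d m (k m)) <->
  (forall x : R, -1 <= x <= 1 ->
     (k 1%N x =
        ginner lam (e0 R) (Top lam (e0 R)) / ginner lam (e0 R) (e0 R)
        - Top lam (e0 R) x)%E /\
     (forall m : nat, (1 < m)%N ->
        (k m x =
           Top lam (k m.-1) x
           - ginner lam (e0 R) (Top lam (k m.-1)) / ginner lam (e0 R) (e0 R))%E)).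
Proof.
move=> lam; split=> [sk x x1|rec].
  split=> [|[|[|m]] // _].
    exact: (thinplate_spline_unique hd (sk 1%N isT) (@thinplate_spline_base R d hd)).
  exact: (thinplate_spline_unique hd (sk m.+2 isT)
    (thinplate_spline_step hd (sk m.+1 isT))).
elim=> [//|[_ _|m IH _]].
  apply: (thinplate_spline_eq hd _ (@thinplate_spline_base R d hd)) => x x1.
  by have [] := rec x x1.
apply: (thinplate_spline_eq hd _ (thinplate_spline_step hd (IH isT))) => x x1.
by have [_ /(_ m.+2 isT)] := rec x x1.
Qed.
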